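(* Let $n\ge 0$, $k\ge 2$ be integers and let $G\in\mathcal G^{n,k}$, i.e. $G$ is a directed multigraph (loops and multi-edges allowed) with $n$ vertices each of outdegree $k$. Then (1) $N_1(G)\le 5n^2k\,\alpha(k)^{n-1}$, where $\alpha(k)=\frac{k-1+\sqrt{(k-1)^2+4}}{2}$; and (2) $N_2(G)\le n^2k\,\big((k+1)!\big)^{(n-1)/(k+1)}$.
   Context: A digraph is a finite directed graph possibly containing multi-edges and self-loops; outdegrees are counted with multiplicity. $\mathcal G^{n,k}$ is the set of all digraphs with $n$ vertices in which every vertex has outdegree $k$. A path-cycle is a digraph isomorphic to $(\{v_1,\dots,v_p\},\{(v_i,v_{i+1}):1\le i<p\}\cup\{(v_p,v_m)\})$ for some integers $1\le m\le p$ (a directed path followed by an edge from its last vertex back to some vertex of the path; the case $m=1$ is a directed cycle). $C'(G)$ denotes the number of path-cycles in $G$, i.e. subgraphs of $G$ that are path-cycles, where subgraphs using different parallel edges are counted as distinct. $N_1(G)=C'(G')$, where $G'$ is obtained from $G$ by replacing each multi-edge of multiplicity $k$ with a single edge (multiplicity 1) with the same endpoints. $N_2(G)=C'(\mathrm{Skel}(G))$, where the skeleton $\mathrm{Skel}(G)$ is obtained from $G$ by replacing every multi-edge by an edge of multiplicity 1. *)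

(* Defs.v *)
From HB Require Import structures.
From mathcomp Require Import all_boot all_order all_algebra.
From mathcomp Require Import all_classical all_reals all_analysis.

Set Implicit Arguments.
Unset Strict Implicit.
Unset Printing Implicit Defensive.

Import Order.TTheory GRing.Theory Num.Theory.

(* Parallel edges are distinct elements of [edge], so distinct choices among
   them give distinct subgraphs. *)
Record digraph := Digraph {
  vert : finType;
  edge : finType;
  src : edge -> vert;
  tgt : edge -> vert }.

Definition outdeg (G : digraph) (v : vert G) : nat :=
  #|[set e : edge G | src e == v]|.

Definition mult (G : digraph) (u v : vert G) : nat :=
  #|[set e : edge G | (src e == u) && (tgt e == v)]|.

Definition regular_digraph (n k : nat) (G : digraph) : Prop :=
  #|vert G| = n /\ forall v : vert G, outdeg v = k.

Definition digraph_iso (G H : digraph) : Prop :=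
  exists (f : vert G -> vert H) (g : edge G -> edge H),
    [/\ bijective f, bijective g &
      forall e, src (g e) = f (src e) /\ tgt (g e) = f (tgt e)].

(* Vertices 0, ..., q; the edge leaving i is labelled i and goes to i + 1 when
   i < q, while the edge leaving q goes back to m.  In the usual 1-based
   notation v_1, ..., v_p this is p = q + 1, with closing edge
   (v_p, v_(m + 1)). *)
Definition path_cycle_model (q : nat) (m : 'I_q.+1) : digraph :=
  @Digraph 'I_q.+1 'I_q.+1 id
    (fun i : 'I_q.+1 => if (i < q)%N then inord i.+1 else m).

Definition path_cycle (H : digraph) : Prop :=
  exists (q : nat) (m : 'I_q.+1), digraph_iso H (path_cycle_model m).

Definition subgraph_closed (G : digraph) (X : {set vert G} * {set edge G}) :
    bool :=
  [forall e in X.2, (src e \in X.1) && (tgt e \in X.1)].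

Definition subgraph (G : digraph) : finType :=
  {X : {set vert G} * {set edge G} | subgraph_closed X}.

Section SubgraphDigraph.
Variables (G : digraph) (X : subgraph G).

Lemma subgraph_src (e : {e : edge G | e \in (val X).2}) :
  src (val e) \in (val X).1.
Proof.
by case: e => e eX /=; have /forall_inP/(_ e eX)/andP[] := valP X.
Qed.

Lemma subgraph_tgt (e : {e : edge G | e \in (val X).2}) :
  tgt (val e) \in (val X).1.
Proof.
by case: e => e eX /=; have /forall_inP/(_ e eX)/andP[] := valP X.
Qed.

Definition subgraph_digraph : digraph :=
  @Digraph {v : vert G | v \in (val X).1} {e : edge G | e \in (val X).2}
    (fun e => exist _ (src (val e)) (subgraph_src e))
    (fun e => exist _ (tgt (val e)) (subgraph_tgt e)).

End SubgraphDigraph.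

Definition num_path_cycles (G : digraph) : nat :=
  #|[set X : subgraph G | `[< path_cycle (subgraph_digraph X) >]]|.

Definition digraph_of_mult (V : finType) (w : V -> V -> nat) : digraph :=
  @Digraph V {p : V * V & 'I_(w p.1 p.2)}
    (fun e => (tag e).1) (fun e => (tag e).2).

(* Each multi-edge whose multiplicity satisfies [P] becomes a single edge; all
   other multiplicities are unchanged. *)
Definition collapse (P : pred nat) (G : digraph) : digraph :=
  digraph_of_mult
    (fun u v : vert G => if P (mult u v) then 1%N else mult u v).

Definition skel (G : digraph) : digraph := collapse [pred d | (2 <= d)%N] G.

Definition N1 (k : nat) (G : digraph) : nat :=
  num_path_cycles (collapse (pred1 k) G).

Definition N2 (G : digraph) : nat := num_path_cycles (skel G).

Local Open Scope ring_scope.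

Definition alpha (R : realType) (k : nat) : R :=
  (k%:R - 1 + Num.sqrt ((k%:R - 1) ^+ 2 + 4)) / 2.

(* Main.v *)
(* A path-cycle is a path from u to v together with one of at most k edges
   leaving v, so it suffices to bound, for each of the n^2 pairs (u, v), the
   number N of paths from u to v.

   (2) Adding a loop at every vertex and replacing the out-edges of v by v -> u,
   a path from u to v extends to a permutation all of whose arcs are edges.
   Bregman's bound on permanents, in Schrijver's form, applies with one row of
   sum 1 and the other rows of sum at most k + 1.

   (1) Put b = k - 1 and let a = alpha(k), so a^2 = b a + 1.  N is affine in each
   row of multiplicities, so each row may be taken to be a Fork, an edge of weight
   b and one of weight 1 to distinct targets.  Then N <= product of [cap] over
   the rows other than that of v, where [cap] is a for a Fork and less for a row
   that lost an edge because its target has been visited.  This is proved by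
   induction, splitting N in one of the following ways.
   - A row with one edge p -> d is contracted, unless two other rows have both p
     and d as targets, in which case one splits according to the row used.
   - If all rows are Forks and two of them have the same heavy target c, split
     according to the edge used to enter c.
   - Otherwise the heavy edges form a bijection onto the unvisited vertices;
     follow the two edges x, y leaving the current vertex.  Entering y spoils
     another row, the one whose heavy target is y, and either some row also
     points to x, or x is lost on entering y.
   For b = 1 following the edges from the current vertex always suffices. *)
Require Import Defs.
From HB Require Import structures.
From mathcomp Require Import all_boot all_order all_algebra.
From mathcomp Require Import perm.
From mathcomp Require Import ring lra.

Set Implicit Arguments.
Unset Strict Implicit.
Unset Printing Implicit Defensive.

Import Order.TTheory GRing.Theory Num.Theory.
Local Open Scope ring_scope.

(** * Weighted path sums *)

Section PathSum.
Variables (R : realFieldType) (V : finType) (v : V).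
Implicit Types (A B : V -> V -> R) (U : {set V}) (w a c d : V).

(** The total weight of the paths from w to v whose later vertices are distinct and lie in U, a path
    weighing the product of its entries of A. The fuel |U| suffices, as each step removes a
    vertex. *)
Fixpoint pathsum_rec m A U w : R :=
  if w == v then 1 else
  if m is m'.+1 then \sum_(x in U) A w x * pathsum_rec m' A (U :\ x) x else 0.

Definition pathsum A U w := pathsum_rec #|U| A U w.

Lemma pathsumE A U w :
  pathsum A U w =
  if w == v then 1 else \sum_(x in U) A w x * pathsum A (U :\ x) x.
Proof.
rewrite /pathsum; case E : #|U| => [|m] /=.
  by rewrite (cards0_eq E) big_set0.
case: ifP => // _; apply: eq_bigr => x xU.
by move: E; rewrite (cardsD1 x) xU add1n => -[->].
Qed.

Lemma pathsum_end A U : pathsum A U v = 1.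
Proof. by rewrite pathsumE eqxx. Qed.

Lemma pathsum_step A U w : w != v ->
  pathsum A U w = \sum_(x in U) A w x * pathsum A (U :\ x) x.
Proof. by rewrite pathsumE => /negPf->. Qed.

Lemma walk_ind (P : {set V} -> V -> Prop) :
  (forall U w, (forall x, x \in U -> P (U :\ x) x) -> P U w) ->
  forall U w, P U w.
Proof.
move=> IH U w; have [m] := ubnP #|U|.
elim: m U w => // m IHm U w ltUm; apply: IH => x xU; apply: IHm.
by move: ltUm; rewrite (cardsD1 x) xU add1n ltnS.
Qed.

Lemma pathsum_ge0 A U w : (forall z t, 0 <= A z t) -> 0 <= pathsum A U w.
Proof.
move=> A0; elim/walk_ind: U / w => U w IH; rewrite pathsumE; case: ifP => // _.
by apply: sumr_ge0 => x xU; rewrite mulr_ge0 ?IH.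
Qed.

(** A path never stays in place and stops at v, so the diagonal and row v have no influence. *)
Lemma eq_pathsum A B U w : w \notin U ->
  (forall z t, z \in w |: U -> t \in U -> z != t -> z != v -> A z t = B z t) ->
  pathsum A U w = pathsum B U w.
Proof.
elim/walk_ind: U / w => U w IH wU AB; rewrite !pathsumE.
case: (eqVneq w v) => // wv; apply: eq_bigr => x xU; congr (_ * _).
  by apply: AB; rewrite ?setU11 //; apply: contraNneq wU => ->.
apply: IH => //; first by rewrite !inE eqxx.
move=> z t; rewrite !inE => /orP[/eqP->|/andP[_ zU]] /andP[_ tU] zt zv;
  by apply: AB; rewrite ?inE ?xU ?zU ?orbT.
Qed.

Lemma ler_pathsum A B U w : w \notin U -> (forall z t, 0 <= A z t) ->
  (forall z t, z \in w |: U -> t \in U -> z != t -> z != v -> A z t <= B z t) ->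
  pathsum A U w <= pathsum B U w.
Proof.
elim/walk_ind: U / w => U w IH wU A0 AB; rewrite !pathsumE.
case: (eqVneq w v) => // wv; apply: ler_sum => x xU.
apply: ler_pM => //; first exact: pathsum_ge0.
  by apply: AB; rewrite ?setU11 //; apply: contraNneq wU => ->.
apply: IH => //; first by rewrite !inE eqxx.
move=> z t; rewrite !inE => /orP[/eqP->|/andP[_ zU]] /andP[_ tU] zt zv;
  by apply: AB; rewrite ?inE ?xU ?zU ?orbT.
Qed.

Lemma pathsum_notin A U w : w != v -> v \notin U -> pathsum A U w = 0.
Proof.
elim/walk_ind: U / w => U w IH wv vU; rewrite pathsum_step // big1 // => x xU.
rewrite IH ?mulr0 //; first by apply: contraNneq vU => <-.
by rewrite inE negb_and vU orbT.
Qed.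

Lemma pathsum_unreachable A U w a : w \notin U -> a \in U ->
  (forall z, z \in w |: U -> z != a -> z != v -> A z a = 0) ->
  pathsum A U w = pathsum A (U :\ a) w.
Proof.
elim/walk_ind: U / w => U w IH wU aU Aa; rewrite !pathsumE.
case: (eqVneq w v) => // wv; rewrite (big_setD1 a) //= Aa ?setU11 //; last first.
  by apply: contraNneq wU => ->.
rewrite mul0r add0r; apply: eq_bigr => x; rewrite !inE => /andP[xa xU].
rewrite (IH x) //.
- by rewrite !setDDl setUC.
- by rewrite !inE eqxx.
- by rewrite !inE eq_sym xa.
move=> z; rewrite !inE => /orP[/eqP->|/andP[_ zU]] za zv;
  by apply: Aa; rewrite ?inE ?xU ?zU ?orbT.
Qed.

Lemma pathsum_sink A U w a : w \notin U -> a \in U -> a != v ->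
  (forall t, t \in U -> t != a -> A a t = 0) ->
  pathsum A U w = pathsum A (U :\ a) w.
Proof.
elim/walk_ind: U / w => U w IH wU aU av Aa; rewrite !pathsumE.
case: (eqVneq w v) => // wv; rewrite (big_setD1 a) //= [pathsum _ _ a]pathsum_step //.
rewrite big1 ?mulr0 ?add0r; last first.
  by move=> t; rewrite !inE => /andP[ta tU]; rewrite Aa ?mul0r.
apply: eq_bigr => x; rewrite !inE => /andP[xa xU].
rewrite (IH x) //.
- by rewrite !setDDl setUC.
- by rewrite !inE eqxx.
- by rewrite !inE eq_sym xa.
by move=> t; rewrite !inE => /andP[_ tU]; apply: Aa.
Qed.

(* If a is only followed by d then a can be bypassed: an edge to a becomes an
   edge to d, with its weight multiplied by k = A a d. *)
Definition redirect A a d k z t := A z t + k * A z a *+ (t == d).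

Lemma pathsum_redirect A U w a d : w \notin U -> a \in U -> d \in U ->
  a != d -> a != v ->
  (forall t, t \in U -> t != a -> t != d -> A a t = 0) ->
  pathsum A U w = pathsum (redirect A a d (A a d)) (U :\ a) w.
Proof.
elim/walk_ind: U / w => U w IH wU aU dU ad av Aa; rewrite !pathsumE.
case: (eqVneq w v) => // wv.
have dUa : d \in U :\ a by rewrite !inE eq_sym ad.
rewrite (big_setD1 a) //= (big_setD1 d dUa) //= [RHS](big_setD1 d dUa) /=.
rewrite [redirect _ _ _ _ w d]/redirect eqxx [pathsum _ _ a]pathsum_step // (big_setD1 d dUa) /=.
rewrite [X in _ * (_ + X)]big1 ?addr0; last first.
  by move=> t; rewrite !inE => /and3P[td ta tU]; rewrite Aa ?mul0r.
(* Once d is visited, a is a dead end, and column d, the only one that [redirect] alters, is out of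
   play. *)
have -> : pathsum A (U :\ d) d = pathsum A (U :\ a :\ d) d.
  rewrite (@pathsum_sink _ _ _ a) //.
  - by rewrite !setDDl setUC.
  - by rewrite !inE eqxx.
  - by rewrite !inE ad.
  by move=> t; rewrite !inE => /andP[td tU] ta; apply: Aa.
have -> : pathsum A (U :\ a :\ d) d =
    pathsum (redirect A a d (A a d)) (U :\ a :\ d) d.
  apply: eq_pathsum; first by rewrite !inE eqxx.
  move=> z t _; rewrite !inE => /andP[td _] _ _.
  by rewrite /redirect (negPf td) mulr0n addr0.
rewrite addrA; congr (_ + _); first by rewrite mulr1n; ring.
apply: eq_bigr => x; rewrite !inE => /and3P[xd xa xU].
rewrite {1}/redirect (negPf xd) mulr0n addr0 (IH x) //.
- by rewrite !setDDl setUC.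
- by rewrite !inE eqxx.
- by rewrite !inE eq_sym xa.
- by rewrite !inE eq_sym xd.
by move=> t; rewrite !inE => /andP[_ tU]; apply: Aa.
Qed.

(* A path enters d at most once, so the factor k is paid at most once. *)
Lemma pathsum_scale_col A B U w d k : w \notin U -> 1 <= k ->
  (forall z t, 0 <= A z t) ->
  (forall z t, z \in w |: U -> t \in U -> z != t -> z != v ->
     A z t <= (if t == d then k else 1) * B z t) ->
  (forall z t, 0 <= B z t) ->
  pathsum A U w <= k * pathsum B U w.
Proof.
move=> wU k1 A0 AB B0; elim/walk_ind: U / w wU AB => U w IH wU AB.
rewrite !pathsumE; case: (eqVneq w v) => [_|wv]; first by rewrite mulr1.
rewrite mulr_sumr; apply: ler_sum => x xU.
have wx : w != x by apply: contraNneq wU => ->.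
have := AB w x (setU11 _ _) xU wx wv.
have xUx : x \notin U :\ x by rewrite !inE eqxx.
have sub z : z \in x |: U :\ x -> z \in w |: U.
  by rewrite !inE => /orP[/eqP->|/andP[_ zU]]; rewrite ?xU ?zU orbT.
have p0 : 0 <= pathsum A (U :\ x) x by apply: pathsum_ge0.
have q0 : 0 <= pathsum B (U :\ x) x by apply: pathsum_ge0.
case: (eqVneq x d) => [xd|xd] ABwx.
  have le1 : pathsum A (U :\ x) x <= pathsum B (U :\ x) x.
    apply: ler_pathsum => // z t /sub zU; rewrite !inE => /andP[tx tU] zt zv.
    by have := AB z t zU tU zt zv; rewrite -xd (negPf tx) mul1r.
  by rewrite mulrA; apply: ler_pM.
have le1 : pathsum A (U :\ x) x <= k * pathsum B (U :\ x) x.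
  apply: IH => // z t /sub zU; rewrite !inE => /andP[_ tU]; exact: AB.
rewrite mul1r in ABwx; rewrite mulrCA; exact: ler_pM.
Qed.

Definition del_edge A a c z t := if (z == a) && (t == c) then 0 else A z t.
Definition force_edge A a c z t :=
  if z == a then (if t == c then A a c else 0)
  else if t == c then 0 else A z t.

(** A path using a -> c takes no other edge out of a or into c, so [force_edge] keeps it. Paths
    avoiding both a and c are counted twice, hence an inequality. *)
Lemma pathsum_edge A U w a c : w \notin U -> (forall z t, 0 <= A z t) ->
  pathsum A U w <= pathsum (del_edge A a c) U w + pathsum (force_edge A a c) U w.
Proof.
move=> wU A0.
have D0 z t : 0 <= del_edge A a c z t by rewrite /del_edge; case: ifP.
have F0 z t : 0 <= force_edge A a c z t.
  by rewrite /force_edge; do 2?case: ifP => _.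
elim/walk_ind: U / w wU => U w IH wU; rewrite !pathsumE.
case: (eqVneq w v) => [_|wv]; first by rewrite lerDl ler01.
rewrite -big_split /=; apply: ler_sum => x xU.
have xUx : x \notin U :\ x by rewrite !inE eqxx.
case: (eqVneq w a) => [wa|wa].
  have nota z : z \in x |: U :\ x -> z != a.
    rewrite !inE -wa => /orP[/eqP->|/andP[_ zU]].
      by apply: contraNneq wU => <-.
    by apply: contraNneq wU => <-.
  have -> : pathsum (del_edge A a c) (U :\ x) x = pathsum A (U :\ x) x.
    by apply: eq_pathsum => // z t /nota za _ _ _; rewrite /del_edge (negPf za).
  rewrite /del_edge /force_edge wa eqxx /=; case: (eqVneq x c) => [xc|xc].
    rewrite mul0r add0r; have -> // : pathsum A (U :\ x) x =
        pathsum (force_edge A a c) (U :\ x) x; last by rewrite xc.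
    apply: eq_pathsum => // z t /nota za; rewrite !inE => /andP[tx _] _ _.
    by rewrite /force_edge (negPf za) -xc (negPf tx).
  by rewrite mul0r addr0.
rewrite {1}/del_edge (negPf wa) /= {1}/force_edge (negPf wa).
case: (eqVneq x c) => [xc|xc]; last first.
  by rewrite -mulrDr; apply: ler_wpM2l => //; apply: IH.
(* Here c is entered from a vertex other than a, so a -> c cannot occur later. *)
rewrite mul0r addr0; have -> // : pathsum A (U :\ x) x =
        pathsum (del_edge A a c) (U :\ x) x.
apply: eq_pathsum => // z t _; rewrite !inE => /andP[tx _] _ _.
by rewrite /del_edge -xc (negPf tx) andbF.
Qed.

Definition set_row A a (r : V -> R) z t := if z == a then r t else A z t.

(** A path leaves a at most once, so the sum is affine in row a; its coefficients are read off at
    the zero row and the unit rows. *)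
Lemma pathsum_row_affine A U w a r : w \notin U ->
  let f s := pathsum (set_row A a s) U w in
  f r = f (fun=> 0) +
        \sum_t r t * (f (fun x => (x == t)%:R) - f (fun=> 0)).
Proof.
elim/walk_ind: U / w => U w IH wU /=; case: (eqVneq w v) => [->|wv].
  rewrite !pathsum_end big1 ?addr0 // => t _.
  by rewrite pathsum_end subrr mulr0.
case: (eqVneq w a) => [wa|wa].
  pose g x := pathsum A (U :\ x) x.
  have E s : pathsum (set_row A a s) U w = \sum_(x in U) s x * g x.
    rewrite pathsum_step //; apply: eq_bigr => x xU.
    rewrite {1}/set_row wa eqxx; congr (_ * _); apply: eq_pathsum.
      by rewrite !inE eqxx.
    move=> z t; rewrite !inE => zxU _ _ _; rewrite /set_row -wa.
    case: eqP => // zw; move: zxU; rewrite zw (negPf wU) andbF orbF => /eqP wx.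
    by rewrite wx xU in wU.
  have E0 : pathsum (set_row A a (fun=> 0)) U w = 0.
    by rewrite E big1 // => x _; rewrite mul0r.
  rewrite E0 add0r E [RHS](bigID (mem U)) /= [X in _ = _ + X]big1 ?addr0.
    apply: eq_bigr => t tU; rewrite subr0 E (big_setD1 t) //= eqxx mul1r.
    rewrite big1 ?addr0 // => x; rewrite !inE => /andP[/negPf-> _].
    by rewrite mul0r.
  move=> t tU; rewrite subr0 E big1 ?mulr0 // => x xU.
  by case: eqP => [xt|]; rewrite ?mul0r // -xt xU in tU *.
have E s : pathsum (set_row A a s) U w =
    \sum_(x in U) A w x * pathsum (set_row A a s) (U :\ x) x.
  rewrite pathsum_step //; apply: eq_bigr => x xU.
  by rewrite {1}/set_row (negPf wa).
rewrite !E; under [in RHS]eq_bigr => t _ do rewrite E -sumrB mulr_sumr.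
rewrite exchange_big /= -big_split /=; apply: eq_bigr => x xU.
rewrite (IH x xU) ?inE ?eqxx // mulrDr mulr_sumr; congr (_ + _).
by apply: eq_bigr => t _; ring.
Qed.

End PathSum.

(** * Rows with at most two targets *)

(* [Fork x y] has a heavy edge, of weight b, to x and a light edge, of weight 1,
   to y. *)
Inductive outrow (R V : Type) := Sink | Arc of R & V | Fork of V & V.
Arguments Sink {R V}.
Arguments Fork {R V}.

Section Capacity.
Variables (R : realFieldType) (V : finType) (v : V) (a b : R).
Hypotheses (b_ge1 : 1 <= b) (a_gt0 : 0 < a) (aE : a * a = b * a + 1).
Implicit Types (r : outrow R V) (ty : V -> outrow R V) (U : {set V}).
Implicit Types (w x y z t c d p q : V) (k : R) (G : V -> R).

Definition row_weight r t : R :=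
  match r with
  | Sink => 0
  | Arc k x => k *+ (t == x)
  | Fork x y => b *+ (t == x) + 1 *+ (t == y)
  end.

Definition points r t : bool :=
  match r with
  | Sink => false
  | Arc _ x => t == x
  | Fork x y => (t == x) || (t == y)
  end.

Definition unlink t r :=
  match r with
  | Sink => Sink
  | Arc k x => if t == x then Sink else r
  | Fork x y => if t == x then Arc 1 y else if t == y then Arc b x else r
  end.

Definition outsize r : nat :=
  match r with Sink => 0 | Arc _ _ => 1 | Fork _ _ => 2 end.

Definition wf r : bool :=
  match r with Sink => true | Arc k _ => 1 <= k | Fork x y => x != y end.

(* The value [(b * k + 1) / a] makes a Fork with targets p, d together with
   [Arc k d] at p worth at least the total weight [b * k + 1] from it to d. *)
Definition cap r : R :=
  match r with
  | Sink => 1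
  | Arc k _ => Num.max k ((b * k + 1) / a)
  | Fork _ _ => a
  end.

Let i := a^-1.
Let ai : a * i = 1. Proof. by rewrite mulfV // gt_eqF. Qed.
Let iE : i = a - b.
Proof. by apply: (mulfI (lt0r_neq0 a_gt0)); rewrite ai mulrBr aE; ring. Qed.
Let i_gt0 : 0 < i. Proof. by rewrite invr_gt0. Qed.
Let b_lt_a : b < a. Proof. by move: i_gt0; rewrite iE subr_gt0. Qed.
Let i_le1 : i <= 1. Proof. by rewrite invf_le1 // (le_trans b_ge1) // ltW. Qed.
Let a_leb1 : a <= b + 1. Proof. by move: i_le1; rewrite iE; lra. Qed.

(** This is b * i <= a * i = 1 with i = a - b. It makes the second term the maximum in
    [cap (Arc b x)]. *)
Let ab_le : a * b <= b ^+ 2 + 1.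
Proof.
have := ler_wpM2r (ltW i_gt0) (ltW b_lt_a); rewrite ai iE; nra.
Qed.

Lemma cap_arc1 x : cap (Arc 1 x) = (b + 1) * i.
Proof.
rewrite /= mulr1; apply/max_idPr; rewrite ler_pdivlMr // mul1r; exact: a_leb1.
Qed.

Lemma cap_arcb x : cap (Arc b x) = (b ^+ 2 + 1) * i.
Proof.
by rewrite /= -expr2; apply/max_idPr; rewrite ler_pdivlMr // mulrC.
Qed.

(* [(b + 1) / a] and [(b ^+ 2 + 1) / a] are the values of [cap] for a Fork that
   has lost its heavy, respectively light, edge. *)
Let s1_le : (b + 1) * i <= (b ^+ 2 + 1) * i.
Proof. rewrite ler_pM2r //; have := b_ge1; nra. Qed.
Let s2_le : (b ^+ 2 + 1) * i <= a.
Proof. rewrite ler_pdivrMr // aE expr2; have := b_ge1; have := b_lt_a; nra. Qed.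

Lemma cap_ge1 r : wf r -> 1 <= cap r.
Proof. by case: r => //= [k _ k1|x y _]; [rewrite le_max k1|exact: le_trans b_ge1 (ltW b_lt_a)]. Qed.

Lemma wf_unlink t r : wf r -> wf (unlink t r).
Proof. by case: r => //= [k x|x y] H; do 2?case: ifP => _ //=. Qed.

Lemma cap_unlink t r : wf r -> cap (unlink t r) <= cap r.
Proof.
case: r => // [k x|x y] H; rewrite [unlink _ _]/=.
  by case: ifP => // _; apply: (@cap_ge1 (Arc k x)).
case: ifP => _; first by rewrite cap_arc1; apply: le_trans s1_le _.
by case: ifP => _ //; rewrite cap_arcb.
Qed.

(** Losing the light edge leaves the larger capacity, so its ratio covers both losses. *)
Lemma cap_unlink_fork t x y : points (Fork x y) t ->
  cap (unlink t (Fork x y)) <= (b ^+ 2 + 1) * i * i * a.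
Proof.
rewrite -[leRHS]mulrA [i * a]mulrC ai mulr1 [points _ _]/= [unlink _ _]/=.
by case: (t == x) => [_|/= ->]; rewrite ?cap_arc1 ?cap_arcb.
Qed.

Lemma outsize_unlink t r : (outsize (unlink t r) <= outsize r)%N.
Proof. by case: r => //= [k x|x y]; do 2?case: ifP. Qed.

Lemma outsize_unlink_lt t r : points r t -> (outsize (unlink t r) < outsize r)%N.
Proof. by case: r => //= [k x ->|x y /orP[->|->]] //; case: ifP. Qed.

Lemma weight_unlink t r x : wf r ->
  row_weight (unlink t r) x = if x == t then 0 else row_weight r x.
Proof.
case: r => /= [|k y|y z] H; first by case: ifP.
  case: (eqVneq t y) => [ty|ty] /=.
    by rewrite -ty; case: (x == t).
  by case: (eqVneq x t) => [->|]; rewrite ?(negPf ty).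
case: (eqVneq t y) => [ty|ty] /=.
  rewrite -ty in H *; case: (eqVneq x t) => [->|xt] /=; rewrite ?(negPf H) //.
  by rewrite mulr0n add0r.
case: (eqVneq t z) => [tz|tz] /=.
  rewrite -tz in H *; case: (eqVneq x t) => [->|xt] /=; rewrite ?(negPf ty) //.
  by rewrite mulr0n addr0.
by case: (eqVneq x t) => [->|xt] //; rewrite (negPf ty) (negPf tz) addr0.
Qed.

Lemma weight_points r t : ~~ points r t -> row_weight r t = 0.
Proof.
case: r => //= [k x /negPf-> //|x y].
by rewrite negb_or => /andP[/negPf-> /negPf->]; rewrite addr0.
Qed.

Lemma weight_ge0 r t : wf r -> 0 <= row_weight r t.
Proof.
case: r => //= [k x k1|x y _]; first by rewrite mulrn_wge0 //; move: b_ge1; lra.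
by rewrite addr_ge0 ?mulrn_wge0 //; move: b_ge1; lra.
Qed.

(** * The potential and the elementary induction steps *)

Definition weights ty z t := row_weight (ty z) t.
Definition walks ty U w := pathsum v (weights ty) U w.
Definition capat ty (S : {set V}) z := if z \in S then cap (ty z) else 1.
(** Visited rows contribute 1, and so does row v, a Sink in every [good] configuration. *)
Definition pot ty U w := \prod_z capat ty (w |: U) z.
(** A ratio of potentials is bounded by a product of [bump]s, one for each row whose capacity
    changes; [prod_bump] evaluates it. *)
Definition bump q k z : R := if z == q then k else 1.
Definition good ty U w := [/\ forall z, wf (ty z), ty v = Sink & w \notin U].
(** The induction measure: it drops when a vertex or an edge is removed. *)
Definition size_of ty U := (#|U| + \sum_z outsize (ty z))%N.
Definition bounded_below n := forall ty U w, good ty U w -> (size_of ty U < n)%N ->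
  walks ty U w <= pot ty U w.

Lemma prod_bump q k : \prod_z bump q k z = k.
Proof.
rewrite (bigD1 q) //= /bump eqxx big1 ?mulr1 // => z /negPf->//.
Qed.

Lemma capat_ge1 ty S z : wf (ty z) -> 1 <= capat ty S z.
Proof. by move=> H; rewrite /capat; case: ifP => // _; apply: cap_ge1. Qed.

Lemma pot_ge1 ty U w : (forall z, wf (ty z)) -> 1 <= pot ty U w.
Proof.
move=> H; rewrite /pot; elim/big_ind: _ => // [x y x1 y1|z _].
  by rewrite -[1]mul1r; apply: ler_pM.
exact: capat_ge1.
Qed.

Lemma pot_ratio G ty' U' w' ty U w :
  (forall z, wf (ty' z)) -> (forall z, wf (ty z)) ->
  (forall z, capat ty' (w' |: U') z <= G z * capat ty (w |: U) z) ->
  pot ty' U' w' <= (\prod_z G z) * pot ty U w.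
Proof.
move=> H' H le; rewrite /pot -big_split /=; apply: ler_prod => z _.
by rewrite le andbT; apply: le_trans (capat_ge1 _ (H' z)).
Qed.

Lemma outsize_sum_le ty' ty : (forall z, outsize (ty' z) <= outsize (ty z))%N ->
  (\sum_z outsize (ty' z) <= \sum_z outsize (ty z))%N.
Proof. by move=> H; apply: leq_sum. Qed.

Lemma outsize_sum_lt q ty' ty :
  (forall z, outsize (ty' z) <= outsize (ty z))%N ->
  (outsize (ty' q) < outsize (ty q))%N ->
  (\sum_z outsize (ty' z) < \sum_z outsize (ty z))%N.
Proof.
move=> H Hq; rewrite (bigD1 q) // [X in (_ < X)%N](bigD1 q) //=.
by rewrite -addSn leq_add // leq_sum.
Qed.

Lemma cardD1_lt U x : x \in U -> (#|U :\ x| < #|U|)%N.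
Proof. by move=> xU; rewrite [X in (_ < X)%N](cardsD1 x) xU. Qed.

(** After entering x no edge into x can be used, so the induction hypothesis applies to the rows
    with x unlinked. The row of w leaves the product, which is why G w may be as small as the
    inverse of its capacity. *)
Lemma walk_bound n G ty U w x :
  bounded_below n -> (size_of ty U <= n)%N ->
  good ty U w ->
  x \in U ->
  (forall z, z \in U -> cap (unlink x (ty z)) <= G z * cap (ty z)) ->
  1 <= G w * cap (ty w) -> (forall z, z \notin w |: U -> 1 <= G z) ->
  walks ty (U :\ x) x <= (\prod_z G z) * pot ty U w.
Proof.
move=> ih sn [wfty tyv wU] xU G1 Gw G0.
pose ty' z := unlink x (ty z).
have wfty' z : wf (ty' z) by apply: wf_unlink.
have -> : walks ty (U :\ x) x = walks ty' (U :\ x) x.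
  apply: eq_pathsum => [|z t _]; first by rewrite !inE eqxx.
  by rewrite !inE /weights weight_unlink // => /andP[/negPf-> _].
apply: (@le_trans _ _ (pot ty' (U :\ x) x)).
  apply: ih; first by split; rewrite ?inE ?eqxx // /ty' tyv.
  apply: leq_trans sn; rewrite /size_of -addSn leq_add ?cardD1_lt //.
  by apply: outsize_sum_le => z; apply: outsize_unlink.
apply: pot_ratio => // z; rewrite setD1K // /capat.
case: (boolP (z \in U)) => [zU|zU]; first by rewrite in_setU zU orbT G1.
case: (boolP (z \in w |: U)) => [|zwU]; last by rewrite mulr1 G0.
by rewrite in_setU1 (negPf zU) orbF => /eqP->.
Qed.

Lemma cap_unlink_le G ty z x k : wf (ty z) -> k = G z -> 1 <= k ->
  cap (unlink x (ty z)) <= G z * cap (ty z).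
Proof.
move=> H <- k1; apply: (le_trans (cap_unlink x H)).
by rewrite ler_peMl // (le_trans _ (cap_ge1 H)).
Qed.

Lemma walks_end ty U : (forall z, wf (ty z)) -> walks ty U v <= pot ty U v.
Proof. by move=> H; rewrite /walks pathsum_end pot_ge1. Qed.

Definition upd ty q r z := if z == q then r else ty z.

(** A loop or an edge to a vertex outside U is never followed; deleting it lowers the measure and
    does not raise the potential. *)
Lemma normalize n ty U w z t :
  bounded_below n -> (size_of ty U <= n)%N ->
  good ty U w ->
  points (ty z) t -> (t == z) || (t \notin U) -> walks ty U w <= pot ty U w.
Proof.
move=> ih sn [wfty tyv wU] zt tz.
pose ty' := upd ty z (unlink t (ty z)).
have wf' q : wf (ty' q) by rewrite /ty' /upd; case: ifP => // _; apply: wf_unlink.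
have -> : walks ty U w = walks ty' U w.
  apply: eq_pathsum => // q s _ sU qs qv.
  rewrite /weights /ty' /upd; case: (eqVneq q z) => // qz.
  rewrite weight_unlink // qz; case: (eqVneq s t) => // st; move: tz.
  by rewrite -st eq_sym -qz (negPf qs) sU.
apply: (@le_trans _ _ (pot ty' U w)).
  apply: ih.
    split=> //; rewrite /ty' /upd; case: eqP => // vz.
    by move: zt; rewrite -vz tyv.
  apply: leq_trans sn; rewrite /size_of ltn_add2l.
  apply: (@outsize_sum_lt z) => [q|]; rewrite /ty' /upd.
    by case: eqP => // ->; apply: outsize_unlink.
  by rewrite eqxx outsize_unlink_lt.
rewrite -[leRHS]mul1r -[X in _ <= X * _](prod_bump z 1).
apply: pot_ratio => // q; rewrite /bump if_same mul1r /capat.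
case: ifP => // _; rewrite /ty' /upd; case: eqP => // ->.
exact: cap_unlink.
Qed.

Lemma pot_sub ty U w p : (forall z, wf (ty z)) -> p \in U ->
  pot ty (U :\ p) w <= pot ty U w.
Proof.
move=> H pU; rewrite -[leRHS]mul1r -[X in _ <= X * _](prod_bump p 1).
apply: pot_ratio => // q; rewrite /bump if_same mul1r /capat !inE.
case: (eqVneq q w) => //= _; case: (eqVneq q p) => //= _.
by case: ifP => // _; apply: cap_ge1.
Qed.

Lemma sink_step n ty U w p :
  bounded_below n -> (size_of ty U <= n)%N ->
  good ty U w ->
  p \in U -> p != v -> ty p = Sink -> walks ty U w <= pot ty U w.
Proof.
move=> ih sn [wfty tyv wU] pU pv typ.
rewrite /walks (pathsum_sink (a := p)) //; last by rewrite /weights typ.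
apply: (le_trans _ (pot_sub w wfty pU)); apply: ih.
  by split; rewrite // inE (negPf wU) andbF.
by apply: leq_trans sn; rewrite /size_of ltn_add2r cardD1_lt.
Qed.

(** The row of w leaves the potential, and its capacity is at least the weight k of the edge
    taken. *)
Lemma arc_step n ty U w k x :
  bounded_below n -> (size_of ty U <= n)%N ->
  good ty U w ->
  w != v -> ty w = Arc k x -> x \in U -> walks ty U w <= pot ty U w.
Proof.
move=> ih sn gd wv tyw xU; have [wfty tyv wU] := gd.
have k1 : 1 <= k by have := wfty w; rewrite tyw.
rewrite /walks pathsum_step // (big_setD1 x) //= [X in _ + X]big1 ?addr0; last first.
  by move=> t; rewrite !inE /weights tyw /= => /andP[/negPf-> _]; rewrite mul0r.
have c0 : 0 < cap (ty w) by apply: lt_le_trans (cap_ge1 _).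
have le : walks ty (U :\ x) x <= (\prod_z bump w (cap (ty w))^-1 z) * pot ty U w.
  apply: (walk_bound ih) => //.
  - move=> z zU; apply: cap_unlink_le => //.
    by rewrite /bump; case: eqP => // zw; rewrite -zw zU in wU.
  - by rewrite /bump eqxx mulVf ?gt_eqF.
  - by move=> z; rewrite /bump !inE; case: eqP.
rewrite prod_bump in le; rewrite {1}/weights tyw /= eqxx mulr1n.
apply: (le_trans (ler_wpM2l _ le)); first by move: b_ge1; lra.
rewrite mulrA ler_piMl //; first by apply: le_trans (pot_ge1 _ _ _).
by rewrite ler_pdivrMr // mul1r tyw /= le_max lexx.
Qed.

(* Effect on a row of bypassing p, whose only edge goes to d with weight k, after
   dividing the weight of every edge into d by k. *)
Definition reroute p d k r :=
  match r with
  | Sink => Sink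
  | Arc l x => Arc l (if x == p then d else x)
  | Fork x y =>
      if (x == p) && (y == d) then Arc (b + k^-1) d
      else if (x == d) && (y == p) then Arc (1 + b / k) d
      else Fork (if x == p then d else x) (if y == p then d else y)
  end.

Lemma wf_reroute p d k r : 1 <= k -> wf r -> wf (reroute p d k r).
Proof.
move=> k1; have k0 : 0 < k^-1 by rewrite invr_gt0; apply: lt_le_trans k1.
case: r => //= x y xy; case: ifP => [_|/negbT E1] /=.
  by move: b_ge1 k0; lra.
case: ifP => [_|/negbT E2] /=.
  by rewrite lerDl mulr_ge0 ?ltW //; apply: lt_le_trans b_ge1.
move: E1 E2; rewrite !negb_and.
case: (eqVneq x p) => [xp|xp]; case: (eqVneq y p) => [yp|yp] //=.
- by rewrite xp yp eqxx in xy.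
- by rewrite eq_sym => ->.
- by rewrite orbF.
Qed.

Lemma outsize_reroute p d k r : (outsize (reroute p d k r) <= outsize r)%N.
Proof. by case: r => //= x y; do 2?case: ifP. Qed.

Lemma cap_reroute p d k r : ~~ (points r p && points r d) -> p != d ->
  cap (reroute p d k r) = cap r.
Proof.
case: r => //= x y np pd; case: ifP => [/andP[/eqP E1 /eqP E2]|_].
  by move: np; rewrite E1 E2 !eqxx orbT.
by case: ifP => // /andP[/eqP E1 /eqP E2]; move: np; rewrite E1 E2 !eqxx orbT.
Qed.

(** An edge redirected from p to d has its weight multiplied by k, and an old edge into d gains
    slack since 1 <= k. A Fork with targets p and d has total weight b * k + 1 or b + k into d,
    which is k times the weight of the new Arc. *)
Lemma weight_reroute p d k r t : 1 <= k -> t != p -> wf r ->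
  row_weight r t + k * row_weight r p *+ (t == d)
  <= (if t == d then k else 1) * row_weight (reroute p d k r) t.
Proof.
move=> k1 tp; have k0 : k != 0 by rewrite gt_eqF //; apply: lt_le_trans k1.
have B1 := b_ge1.
case: r => [|l x|x y] /= H; first by rewrite mulr0 mul0rn mulr0 addr0.
  case: (eqVneq x p) => [->|xp].
    by rewrite (negPf tp) ?eqxx; case: (t == d); rewrite ?mulr0n ?mulr1n; nra.
  by case: (t == d); case: (_ == _);
    rewrite ?mulr0n ?mulr1n; nra.
case: (eqVneq x p) => [xp|xp].
  have yp : p != y by rewrite -xp.
  rewrite ?xp (negPf tp) (negPf yp) ?eqxx /=.
  case: (eqVneq y d) => [->|yd] /=.
    case: (t == d); rewrite ?mulr0n ?mulr1n; last by lra.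
    by have := divff k0; nra.
  rewrite [y == p]eq_sym (negPf yp) ?andbF /=.
  by case: (t == d); case: (t == y); rewrite ?mulr0n ?mulr1n; nra.
rewrite /=.
case: (eqVneq y p) => [yp|yp] /=.
  rewrite ?yp (negPf tp) ?eqxx ?andbT /=; case: (eqVneq x d) => [->|xd] /=.
    case: (t == d); rewrite ?mulr0n ?mulr1n; last by lra.
    by have := divff k0; nra.
  by case: (t == d); case: (t == x); rewrite ?mulr0n ?mulr1n; nra.
rewrite ?andbF /=.
by case: (t == d); case: (t == x); case: (t == y); rewrite ?mulr0n ?mulr1n; nra.
Qed.

(** Bypass p, then take the factor k out of column d, which a path enters at most once. *)
Lemma contract ty U w p d k : good ty U w -> p \in U -> d \in U -> p != d ->
  p != v -> ty p = Arc k d ->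
  walks ty U w <= k * walks (fun z => reroute p d k (ty z)) (U :\ p) w.
Proof.
move=> [wfty tyv wU] pU dU pd pv typ.
have k1 : 1 <= k by have := wfty p; rewrite typ.
have pdk : weights ty p d = k by rewrite /weights typ /= eqxx.
rewrite /walks (pathsum_redirect (a := p) (d := d)) //; last first.
  by move=> t _ _ td; rewrite /weights typ /= (negPf td).
have W0 z t : 0 <= weights ty z t by apply: weight_ge0.
apply: (pathsum_scale_col (d := d)) => //.
- by rewrite inE (negPf wU) andbF.
- by move=> z t; rewrite /redirect pdk addr_ge0 ?mulrn_wge0 ?mulr_ge0 //; lra.
- move=> z t _; rewrite !inE => /andP[tp _] _ _.
  by rewrite /redirect pdk; apply: weight_reroute.
- by move=> z t; apply: weight_ge0; apply: wf_reroute.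
Qed.

Lemma cap_arc_lb k x : a * k <= a * cap (Arc k x) /\ b * k + 1 <= a * cap (Arc k x).
Proof.
split; first by rewrite ler_pM2l //= le_max lexx.
by rewrite [leRHS]mulrC -ler_pdivrMr //= le_max lexx orbT.
Qed.

(** When a Fork with targets p and d is merged into one Arc, the capacity of p, which disappears,
    pays for the factor k of [contract]. *)
Lemma cap_double p d k x y z : 1 <= k -> p != d -> x != y ->
  points (Fork x y) p && points (Fork x y) d ->
  cap (reroute p d k (Fork x y)) * k <= a * cap (Arc k z).
Proof.
move=> k1 pd xy xypd; have k0 : 0 < k by apply: lt_le_trans k1.
have [H1 H2] := cap_arc_lb k z; set M := a * cap (Arc k z) in H1 H2 *.
have B1 := b_ge1; have I0 := i_gt0; have IE := iE; have AI := ai.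
have key : b ^+ 2 * k + b + k <= a * M.
  (* As i = a - b, a <= k holds exactly when b * k + 1 <= a * k, so the cases tell which term of the
     maximum in [cap (Arc k z)] is larger. *)
  have [ka|ka] := lerP a k.
    have le1 : a * k * a <= M * a by rewrite ler_pM2r.
    have ik : 1 <= i * k by rewrite mulrC ler_pdivlMr // mul1r.
    have E1 : a * k * a = (b * a + 1) * k by rewrite -aE; ring.
    have le2 : b <= b * ((a - b) * k) by rewrite ler_peMr -?IE //; lra.
    move: le1 le2; rewrite E1 [M * a]mulrC.
    move: (a * M) => aM.
    by nra.
  have ik : i * k <= 1 by rewrite mulrC ler_pdivrMr // mul1r ltW.
  have : a * (b * k + 1) <= a * M by rewrite ler_pM2l.
  have : k * (i * i) <= i by rewrite mulrA [k * i]mulrC ler_piMl // ltW.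
  have -> : i * i = b ^+ 2 + 1 - a * b.
    by rewrite {2}IE mulrBr [i * a]mulrC AI IE; ring.
  rewrite IE; lra.
have {xypd}: (x == p) && (y == d) \/ (x == d) && (y == p).
  case/andP: xypd => /orP[]/eqP E1 /orP[]/eqP E2.
  - by rewrite E2 E1 eqxx in pd.
  - by left; rewrite E1 E2 !eqxx.
  - by right; rewrite E1 E2 !eqxx.
  - by rewrite E2 E1 eqxx in pd.
case=> E; rewrite [reroute _ _ _ _]/= E.
  rewrite /= (maxr_pMl _ _ (ltW k0)) ge_max; apply/andP; split.
    by rewrite mulrDl mulVf ?gt_eqF.
  rewrite mulrAC ler_pdivrMr //.
  have -> : (b * (b + k^-1) + 1) * k = b ^+ 2 * k + b + k.
    by field; rewrite gt_eqF.
  by rewrite [M * a]mulrC.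
have E' : (x == p) && (y == d) = false.
  by apply: contraNF pd => /andP[/eqP <- _]; case/andP: E.
rewrite E' /= (maxr_pMl _ _ (ltW k0)) ge_max; apply/andP; split.
  rewrite mulrDl mul1r divfK ?gt_eqF //; apply: le_trans H2; nra.
rewrite mulrAC ler_pdivrMr // [M * a]mulrC; apply: le_trans key.
have -> : (b * (1 + b / k) + 1) * k = b * k + b ^+ 2 + k.
  by field; rewrite gt_eqF.
(* This is the difference between the left side of [key] and the value needed here. *)
have : 0 <= b * ((k - 1) * (b - 1)).
  by rewrite !mulr_ge0 ?subr_ge0 // (le_trans ler01).
by lra.
Qed.

(** The ratios at p and q multiply to 1 / k, which cancels the factor k of [contract]; every other
    row keeps its capacity. *)
Lemma contract_step n ty U w p d k q :
  bounded_below n -> (size_of ty U <= n)%N ->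
  good ty U w -> p \in U -> d \in U -> p != d -> ty p = Arc k d -> q != p ->
  (forall z, z \in w |: U -> points (ty z) p && points (ty z) d -> z = q) ->
  walks ty U w <= pot ty U w.
Proof.
move=> ih sn gd pU dU pd typ qp Hq; have [wfty tyv wU] := gd.
have k1 : 1 <= k by have := wfty p; rewrite typ.
have k0 : 0 < k by apply: lt_le_trans k1.
have pv : p != v by apply/eqP => E; rewrite E tyv in typ.
apply: (le_trans (contract gd pU dU pd pv typ)).
set ty' := fun z => _; have C1 := cap_ge1 (wfty p).
have C0 : 0 < cap (ty p) by apply: lt_le_trans C1.
have Ck : k <= cap (ty p) by rewrite typ /= le_max lexx.
have Ck1 : 1 <= cap (ty p) / k by rewrite ler_pdivlMr // mul1r.
have wf' z : wf (ty' z) by apply: wf_reroute.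
have le : walks ty' (U :\ p) w <=
    (\prod_z (bump p (cap (ty p))^-1 z * bump q (cap (ty p) / k) z)) * pot ty U w.
  apply: (@le_trans _ _ (pot ty' (U :\ p) w)).
    apply: ih; first by split=> //; rewrite ?inE ?(negPf wU) ?andbF // /ty' tyv.
    apply: leq_trans sn; rewrite /size_of -addSn leq_add ?cardD1_lt //.
    by apply: outsize_sum_le => z; apply: outsize_reroute.
  apply: pot_ratio => // z; rewrite /bump /capat !inE.
  have [->|zp] := eqVneq z p.
    have -> : (p == w) = false by apply: contraNF wU => /eqP<-.
    by rewrite pU /= eq_sym (negPf qp) mulr1 mulVf ?gt_eqF.
  rewrite mul1r /=; case: ifP => zU; last first.
    by rewrite mulr1; case: ifP.
  have [/andP[zp' zd']|nd] := boolP (points (ty z) p && points (ty z) d).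
    have -> : z == q by apply/eqP/Hq; rewrite ?inE ?zU // zp'.
    rewrite mulrAC ler_pdivlMr // [cap _ * cap _]mulrC /ty'.
    move: zp' zd' (wfty z); case: (ty z) => [|l x|x y] //.
      by move=> /= /eqP E1 /eqP E2; rewrite E2 E1 eqxx in pd.
    by move=> zp' zd' /= xy; rewrite typ; apply: cap_double => //; rewrite zp'.
  rewrite /ty' cap_reroute //; case: ifP => _; last by rewrite mul1r.
  by rewrite ler_peMl // (le_trans _ (cap_ge1 (wfty z))).
rewrite big_split /= !prod_bump in le.
apply: (le_trans (ler_wpM2l (ltW k0) le)).
by rewrite mulKf ?gt_eqF // mulrA divff ?gt_eqF // mul1r.
Qed.

Lemma double_fork r p d : p != d -> points r p -> points r d ->
  r = Fork p d \/ r = Fork d p.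
Proof.
move=> pd; case: r => //= [k x|x y] /=.
  by move=> /eqP E1 /eqP E2; rewrite E2 E1 eqxx in pd.
move=> /orP[]/eqP E1 /orP[]/eqP E2; rewrite E1 E2 ?eqxx in pd *; by [|left|right].
Qed.

(** With p bypassed and d reserved for q, the row q' becomes a Sink and q an Arc of weight at most b
    * k + 1. Since b * k + 1 <= a * cap (ty p), the rows p and q cost nothing together, and q' saves
    the factor a. Allowing any A below [redirect] covers the case where another edge was deleted
    first. *)
Lemma double_force n ty U w p d k q q' (A : V -> V -> R) :
  bounded_below n -> (size_of ty U <= n)%N -> good ty U w -> p \in U -> d \in U ->
  p != d -> ty p = Arc k d -> q \in w |: U -> q' \in w |: U -> q != q' ->
  points (ty q) p -> points (ty q) d -> points (ty q') p -> points (ty q') d ->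
  (forall z t, 0 <= A z t <= redirect (weights ty) p d k z t) ->
  pathsum v (force_edge A q d) (U :\ p) w <= i * pot ty U w.
Proof.
move=> ih sn [wfty tyv wU] pU dU pd typ qU q'U qq' qp qd q'p q'd HA.
have k1 : 1 <= k by have := wfty p; rewrite typ.
have B1 := b_ge1.
have qNp : q != p by apply: contraTneq qp => ->; rewrite typ.
have q'Np : q' != p by apply: contraTneq q'p => ->; rewrite typ.
have pw : p != w by apply: contraNneq wU => <-.
pose ty1 z := if z == q then Arc (b * k + 1) d else unlink d (unlink p (ty z)).
have wf1 z : wf (ty1 z).
  rewrite /ty1; case: ifP => _ /=; last by do 2!apply: wf_unlink.
  by rewrite lerDr; nra.
(* The first term of the maximum wins because b * k + 1 >= b + 1 >= a. *)
have capq : cap (Arc (b * k + 1) d) = b * k + 1.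
  rewrite /=; apply/max_idPl; rewrite ler_pdivrMr //.
  have : 1 <= i * (b * k + 1).
    rewrite mulrC ler_pdivlMr // mul1r; apply: (le_trans a_leb1); nra.
  by rewrite iE; nra.
have A0 z t : 0 <= A z t by case/andP: (HA z t).
have C0 : 0 < cap (ty p) by apply: lt_le_trans (cap_ge1 _).
apply: (@le_trans _ _ (walks ty1 (U :\ p) w)).
  apply: ler_pathsum => [|z t|z t _].
  - by rewrite inE (negPf wU) andbF.
  - by rewrite /force_edge; do 2?case: ifP => _.
  rewrite !inE => /andP[tp _] _ _; rewrite /force_edge /weights /ty1.
  have /andP[_] := HA z t; rewrite /redirect.
  case: (eqVneq z q) => [->|zq]; case: (eqVneq t d) => [->|td] //=.
  - rewrite ?mulr1n => /le_trans-> //.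
    by rewrite /weights; case: (double_fork pd qp qd) => -> /=;
      rewrite ?eqxx ?[d == p]eq_sym ?(negPf pd) /= ?mulr0n ?mulr1n; nra.
  - by rewrite (negPf td) !mulr0n lexx.
  - by move=> _; apply: weight_ge0; do 2!apply: wf_unlink.
  rewrite mulr0n addr0 => /le_trans->//.
  by rewrite !weight_unlink ?wf_unlink // (negPf td) (negPf tp).
apply: (@le_trans _ _ (pot ty1 (U :\ p) w)).
  apply: ih.
    split; rewrite ?inE ?(negPf wU) ?andbF // /ty1 tyv.
    by case: eqP qp => // <-; rewrite tyv.
  apply: leq_trans sn; rewrite /size_of -addSn leq_add ?cardD1_lt //.
  apply: outsize_sum_le => z; rewrite /ty1.
  have [->|_] := eqVneq z q; first by case: (double_fork pd qp qd) => ->.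
  by apply: leq_trans (outsize_unlink _ _) (outsize_unlink _ _).
pose G z := bump p (cap (ty p))^-1 z * bump q ((b * k + 1) * i) z * bump q' i z.
have le : pot ty1 (U :\ p) w <= (\prod_z G z) * pot ty U w.
  apply: pot_ratio => // z; rewrite /G /bump /capat !inE.
  have [->|zp] := eqVneq z p.
    rewrite pU (negPf pw) /= ![p == _]eq_sym (negPf qNp) (negPf q'Np) !mulr1.
    by rewrite mulVf ?gt_eqF.
  rewrite mul1r /=; case: (boolP ((z == w) || (z \in U))) => zU; last first.
    have /negPf-> : z != q by apply: contraNneq zU => ->; rewrite -in_setU1.
    have /negPf-> : z != q' by apply: contraNneq zU => ->; rewrite -in_setU1.
    by rewrite !mulr1.
  rewrite /ty1; case: (eqVneq z q) => [->|zq].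
    rewrite (negPf qq') mulr1 capq.
    by case: (double_fork pd qp qd) => -> /=; rewrite -mulrA [i * a]mulrC ai mulr1.
  case: (eqVneq z q') => [->|zq'].
    rewrite mul1r; case: (double_fork pd q'p q'd) => ->;
      rewrite /= ?eqxx ?[_ == p]eq_sym ?(negPf pd) ?[_ == d]eq_sym ?(negPf pd) /= ?eqxx /=;
      by rewrite [i * a]mulrC ai.
  by rewrite !mul1r (le_trans (cap_unlink _ _)) ?wf_unlink ?cap_unlink.
apply: (le_trans le); apply: ler_wpM2r.
  by apply: le_trans (pot_ge1 _ _ _).
rewrite /G !big_split /= !prod_bump ler_piMl ?(ltW i_gt0) //.
rewrite mulrC ler_pdivrMr // mul1r ler_pdivrMr // typ [leRHS]mulrC.
by case: (cap_arc_lb k d).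
Qed.

(** After bypassing p, split according to whether d is entered from q, from q' or from neither. The
    first two parts have ratio i each. In the third both rows become Sinks, with ratio i * i. *)
Lemma double_step n ty U w p d k q q' : 2 <= b ->
  bounded_below n -> (size_of ty U <= n)%N -> good ty U w -> p \in U -> d \in U ->
  p != d -> ty p = Arc k d -> q \in w |: U -> q' \in w |: U -> q != q' ->
  points (ty q) p -> points (ty q) d -> points (ty q') p -> points (ty q') d ->
  walks ty U w <= pot ty U w.
Proof.
move=> b2 ih sn gd pU dU pd typ qU q'U qq' qp qd q'p q'd.
have [wfty tyv wU] := gd.
have k1 : 1 <= k by have := wfty p; rewrite typ.
have pv : p != v by apply/eqP => E; rewrite E tyv in typ.
have wUp : w \notin U :\ p by rewrite inE (negPf wU) andbF.
have pdk : weights ty p d = k by rewrite /weights typ /= eqxx.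
set A := redirect (weights ty) p d k.
have W0 z t : 0 <= weights ty z t by apply: weight_ge0.
have A0 z t : 0 <= A z t.
  by rewrite /A /redirect addr_ge0 ?mulrn_wge0 ?mulr_ge0 //; lra.
have D0 z t : 0 <= del_edge A q d z t <= A z t.
  by rewrite /del_edge; case: ifP => _; rewrite ?lexx ?A0.
pose ty0 := upd (upd ty q Sink) q' Sink.
have qNp : q != p by apply: contraTneq qp => ->; rewrite typ.
have q'Np : q' != p by apply: contraTneq q'p => ->; rewrite typ.
have wf0 z : wf (ty0 z) by rewrite /ty0 /upd; do 2?case: ifP.
have ty0p : ty0 p = Arc k d.
  by rewrite /ty0 /upd ![p == _]eq_sym (negPf qNp) (negPf q'Np).
have le0 : pathsum v (del_edge (del_edge A q d) q' d) (U :\ p) w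
           <= i * i * pot ty U w.
  (* Away from p, rows q and q' had only d as target, so they are now empty; bypassing p in [ty0]
     gives the same weights. *)
  have -> : pathsum v (del_edge (del_edge A q d) q' d) (U :\ p) w = walks ty0 U w.
    rewrite /walks [RHS](pathsum_redirect (a := p) (d := d)) //; last first.
      by move=> t _ _ td; rewrite /weights ty0p /= (negPf td).
    have -> : weights ty0 p d = k by rewrite /weights ty0p /= eqxx.
    apply: eq_pathsum => // z t _; rewrite !inE => /andP[tp _] _ _.
    rewrite /del_edge /A /redirect /weights /ty0 /upd.
    case: (eqVneq t d) => [->|td]; rewrite ?andbT ?andbF /=.
      by case: (eqVneq z q') => _; [|case: (eqVneq z q) => _]; rewrite ?mulr1n ?mulr0 ?addr0.
    rewrite !mulr0n !addr0.
    case: (eqVneq z q') => [->|_]; [|case: (eqVneq z q) => [->|_] //];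
      [case: (double_fork pd q'p q'd)|case: (double_fork pd qp qd)] => -> /=;
      by rewrite (negPf tp) (negPf td) addr0.
  apply: (@le_trans _ _ (pot ty0 U w)).
    apply: ih; first split=> //.
      by rewrite /ty0 /upd; do 2?case: ifP.
    apply: leq_trans sn; rewrite /size_of ltn_add2l.
    apply: (@outsize_sum_lt q) => [z|]; rewrite /ty0 /upd.
      by do 2?case: ifP.
    by rewrite (negPf qq') eqxx; case: (double_fork pd qp qd) => ->.
  have -> : i * i = \prod_z (bump q i z * bump q' i z).
    by rewrite big_split /= !prod_bump.
  apply: pot_ratio => // z; rewrite /bump /capat /ty0 /upd.
  case: ifP => zU; last first.
    have /negPf-> : z != q by apply: contraFneq zU => ->.
    have /negPf-> : z != q' by apply: contraFneq zU => ->.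
    by rewrite !mulr1.
  case: (eqVneq z q') => [->|zq'].
    rewrite eq_sym (negPf qq') mul1r.
    by case: (double_fork pd q'p q'd) => -> /=; rewrite mulrC ai.
  case: (eqVneq z q) => [->|zq]; last by rewrite !mul1r.
  rewrite mulr1.
  by case: (double_fork pd qp qd) => -> /=; rewrite mulrC ai.
have leq : pathsum v (force_edge A q d) (U :\ p) w <= i * pot ty U w.
  apply: (double_force ih sn gd pU dU pd typ qU q'U qq') => // z t.
  by rewrite A0 lexx.
have leq' : pathsum v (force_edge (del_edge A q d) q' d) (U :\ p) w <= i * pot ty U w.
  by apply: (double_force (q' := q) ih sn gd pU dU pd typ) => //; rewrite eq_sym.
have E : walks ty U w = pathsum v A (U :\ p) w.
  rewrite /walks (pathsum_redirect (a := p) (d := d)) // ?pdk //.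
  by move=> t _ _ td; rewrite /weights typ /= (negPf td).
rewrite E.
have s1 := pathsum_edge v q d wUp A0.
have s2 : pathsum v (del_edge A q d) (U :\ p) w <=
    pathsum v (del_edge (del_edge A q d) q' d) (U :\ p) w +
    pathsum v (force_edge (del_edge A q d) q' d) (U :\ p) w.
  by apply: pathsum_edge => // z t; case/andP: (D0 z t).
have P1 : 1 <= pot ty U w by apply: pot_ge1.
(* By 2 <= b the factor is at most i * i + b * i = 1. *)
have num : (i * i + i + i) * pot ty U w <= pot ty U w.
  rewrite ler_piMl ?(le_trans ler01) //.
  have E1 : b * i + i * i = 1 by rewrite -ai iE; ring.
  have := ler_wpM2r (ltW i_gt0) b2; lra.
by move: s1 s2 le0 leq leq' num; lra.
Qed.

(** * Forks sharing a heavy target *)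

(** If p is the current vertex this is one step. Otherwise p is an Arc to c and is contracted; all
    other rows have c unlinked, so none points to both p and c and rerouting keeps their
    capacities. *)
Lemma fork_force n G ty U w p c y :
  bounded_below n -> (size_of ty U <= n)%N ->
  good ty U w -> p \in w |: U -> c \in U -> p != c -> ty p = Fork c y ->
  (forall z, z \in w |: U -> z != p ->
     cap (unlink c (ty z)) <= G z * cap (ty z)) ->
  1 <= G p * a -> (forall z, z \notin w |: U -> 1 <= G z) ->
  pathsum v (force_edge (weights ty) p c) U w
    <= b * ((\prod_z G z) * pot ty U w).
Proof.
move=> ih sn gd pU cU pc typ HG Gp G0; have [wfty tyv wU] := gd.
have cy : c != y by have := wfty p; rewrite typ.
have pv : p != v by apply/eqP => E; rewrite E tyv in typ.
have b0 : 0 <= b by apply: le_trans b_ge1.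
have pcb : weights ty p c = b.
  by rewrite /weights typ /= eqxx (negPf cy) mulr0n mulr1n addr0.
have [pw|pw] := eqVneq p w.
  rewrite -pw in wU gd HG G0 pU *.
  rewrite pathsum_step // (big_setD1 c) //= [X in _ + X]big1 ?addr0; last first.
    move=> t; rewrite !inE => /andP[tc _].
    by rewrite /force_edge eqxx (negPf tc) mul0r.
  rewrite {1}/force_edge !eqxx pcb; apply: ler_wpM2l => //.
  have -> : pathsum v (force_edge (weights ty) p c) (U :\ c) c = walks ty (U :\ c) c.
    apply: eq_pathsum => [|z t]; first by rewrite !inE eqxx.
    rewrite setD1K // !inE => zU /andP[tc _] _ _.
    rewrite /force_edge (negPf tc); case: eqP => // zp.
    by rewrite -zp zU in wU.
  apply: (walk_bound ih) => //; last by rewrite typ.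
  move=> z zU; apply: HG; first by rewrite inE zU orbT.
  by apply: contraNneq wU => <-.
have {pU}pU : p \in U by move: pU; rewrite in_setU1 (negPf pw).
pose ty1 := upd (fun z => unlink c (ty z)) p (Arc b c).
have wf1 z : wf (ty1 z).
  by rewrite /ty1 /upd; case: ifP => _ //=; apply: wf_unlink.
have -> : pathsum v (force_edge (weights ty) p c) U w = walks ty1 U w.
  apply: eq_pathsum => // z t _ _ _ _.
  rewrite /force_edge pcb /weights /ty1 /upd; case: (eqVneq z p) => _.
    by rewrite /=; case: (t == c).
  by rewrite weight_unlink.
have gd1 : good ty1 U w.
  by split=> //; rewrite /ty1 /upd eq_sym (negPf pv) tyv.
have ty1p : ty1 p = Arc b c by rewrite /ty1 /upd eqxx.
apply: (le_trans (contract gd1 pU cU pc pv ty1p)); apply: ler_wpM2l => //.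
set ty2 := fun z => _.
have wf2 z : wf (ty2 z) by apply: wf_reroute.
apply: (@le_trans _ _ (pot ty2 (U :\ p) w)).
  apply: ih.
    split; rewrite ?inE ?(negPf wU) ?andbF // /ty2 /ty1 /upd.
    by rewrite eq_sym (negPf pv) tyv.
  apply: leq_trans sn; rewrite /size_of -addSn leq_add ?cardD1_lt //.
  apply: outsize_sum_le => z; apply: (leq_trans (outsize_reroute _ _ _ _)).
  rewrite /ty1 /upd; case: eqP => [->|_]; first by rewrite typ.
  exact: outsize_unlink.
apply: pot_ratio => // z; rewrite /capat.
have [->|zp] := eqVneq z p.
  by rewrite !inE eqxx pU (negPf pw) orbT typ.
rewrite !inE zp /=; case: (boolP (_ || _)) => zU; last first.
  by rewrite mulr1 G0 // !inE.
rewrite /ty2 /ty1 /upd (negPf zp) cap_reroute //; last first.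
  apply/negP => /andP[_]; rewrite -[points _ _]negbK => /negP; apply.
  case: (ty z) (wfty z) => //= [l x|x x'] xx'.
    by case: (eqVneq c x).
  case: (eqVneq c x) => [<- //=|cx] in xx' *.
  by case: (eqVneq c x') => //= cx'; rewrite negb_or cx cx'.
by apply: HG; rewrite ?inE.
Qed.

Definition normalized ty U w := forall z t, z \in w |: U -> points (ty z) t ->
  (t != z) && (t \in U).

Let biE : b * i + i * i = 1. Proof. by rewrite -ai iE; ring. Qed.

(* For b = 2 the first bound is nearly an equality: it amounts to
   i = sqrt 2 - 1 <= 169 / 408. *)
Lemma excess_bounds : b = 2 \/ 3 <= b ->
  let s1 := (b + 1) * i in let s2 := (b ^+ 2 + 1) * i in
  2 * (b * (i * (s1 * i) * (s2 * i))) + (s1 * i) * (s1 * i) <= 1 /\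
  2 * (b * (i * (s1 * i))) + i * ((s1 * i) * (s1 * i)) <= 1.
Proof.
have I0 := i_gt0; have E := biE; case=> [b2|b3] s1 s2.
  have i2 : i * i = 1 - 2 * i by move: E; rewrite b2; lra.
  have i3 : i * (i * i) = 5 * i - 2 by rewrite i2; move: i2; lra.
  have i5 : i * i * (i * (i * i)) = 29 * i - 12 by rewrite i3 i2; move: i2; lra.
  have iu : i <= 169 / 408 by rewrite leNgt; apply/negP => H; move: i2; nra.
  split.
    have -> : 2 * (b * (i * (s1 * i) * (s2 * i))) + s1 * i * (s1 * i) =
        60 * (i * i * (i * (i * i))) + 9 * (i * i) * (i * i).
      by rewrite /s1 /s2 b2; ring.
    by rewrite i5 i2; move: i2; lra.
  have -> : 2 * (b * (i * (s1 * i))) + i * (s1 * i * (s1 * i)) =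
      12 * (i * (i * i)) + 9 * (i * i * (i * (i * i))).
    by rewrite /s1 b2; ring.
  by rewrite i5 i3; lra.
(* For b >= 3, i is at most (sqrt 13 - 3) / 2 < 0.303; crude bounds on the products below then
   suffice. *)
have iu : i <= 31 / 100.
  by rewrite leNgt; apply/negP => H; move: E; nra.
pose B := b * i; pose S := (b + 1) * i; pose T := (b ^+ 2 + 1) * i * i.
have B0 : 0 <= B <= 1 by rewrite mulr_ge0 //=; move: E; rewrite /B; nra.
have S0 : 0 <= S <= 131 / 100 by move: B0; rewrite /S /B; lra.
have T0 : 0 <= T <= 1.
  have -> : T = B * B + i * i by rewrite /T /B; ring.
  by move: E; rewrite -/B; nra.
have BS : 0 <= B * S <= 131 / 100 by nra.
have SS : 0 <= S * S <= 18 / 10 by nra.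
have BST : 0 <= B * S * T <= 131 / 100 by nra.
have ii : i * i <= 1 / 10 by nra.
split.
  have -> : 2 * (b * (i * (s1 * i) * (s2 * i))) + s1 * i * (s1 * i) =
      2 * (B * S * T) * i + (S * S) * (i * i).
    by rewrite /s1 /s2 /B /S /T; ring.
  by move: (B * S * T) (S * S) BST SS => x y; nra.
have -> : 2 * (b * (i * (s1 * i))) + i * (s1 * i * (s1 * i)) =
    2 * (B * S) * i + (S * S) * (i * i) * i.
  by rewrite /s1 /B /S; ring.
have : 0 <= S * S * (i * i) <= 18 / 100 by move: (S * S) SS => y; nra.
by move: (S * S * (i * i)) (B * S) BS => x y; nra.
Qed.

(** Row p is used up, with ratio i, and row q loses its heavy edge, with ratio (b + 1) * i * i; g
    records losses in further rows. *)
Lemma forks_force n g ty U w p q c y y' :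
  bounded_below n -> (size_of ty U <= n)%N ->
  good ty U w -> p \in w |: U -> q \in w |: U -> c \in U -> p != c -> p != q ->
  ty p = Fork c y -> ty q = Fork c y' ->
  (forall z, z \in w |: U -> z != p -> z != q ->
     cap (unlink c (ty z)) <= g z * cap (ty z)) ->
  g p = 1 -> g q = 1 -> (forall z, z \notin w |: U -> 1 <= g z) ->
  pathsum v (force_edge (weights ty) p c) U w
    <= b * (i * ((b + 1) * i * i) * \prod_z g z * pot ty U w).
Proof.
move=> ih sn gd pU qU cU pc pq typ tyq Hg gp gq g1.
have -> : i * ((b + 1) * i * i) * \prod_z g z =
    \prod_z (bump p i z * bump q ((b + 1) * i * i) z * g z).
  by rewrite !big_split /= !prod_bump.
apply: (fork_force ih sn gd pU cU pc typ) => [z zU zp||z zU]; rewrite /bump.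
- rewrite (negPf zp) mul1r; case: (eqVneq z q) => [->|zq]; last first.
    by rewrite mul1r Hg.
  by rewrite tyq gq mulr1 [unlink _ _]/= eqxx cap_arc1 -[leRHS]mulrA [i * _]mulrC ai mulr1.
- by rewrite eqxx (negPf pq) gp !mulr1 mulrC ai.
have /negPf-> : z != p by apply: contraNneq zU => ->.
have /negPf-> : z != q by apply: contraNneq zU => ->.
by rewrite !mul1r g1.
Qed.

(** Enter c by the heavy edge of p, by that of q, or by neither. If a third row points to c, it
    loses an edge in the first two parts. If none does, c is unreachable in the last part and its
    capacity a is saved. The two halves of [excess_bounds] match these cases. *)
Lemma excess_step n ty U w c p q y y' :
  b = 2 \/ 3 <= b -> bounded_below n -> (size_of ty U <= n)%N ->
  good ty U w -> w != v -> normalized ty U w ->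
  (forall z, z \in w |: U -> z != v -> exists x x', ty z = Fork x x') ->
  p \in w |: U -> q \in w |: U -> p != q ->
  ty p = Fork c y -> ty q = Fork c y' -> walks ty U w <= pot ty U w.
Proof.
move=> b2 ih sn gd wv nm full pU qU pq typ tyq; have [wfty tyv wU] := gd.
have pcP : points (ty p) c by rewrite typ /= eqxx.
have qcP : points (ty q) c by rewrite tyq /= eqxx.
have /andP[] := nm _ _ pU pcP; rewrite eq_sym => pc cU.
have /andP[] := nm _ _ qU qcP; rewrite eq_sym => qc _.
have cy : c != y by have := wfty p; rewrite typ.
have cy' : c != y' by have := wfty q; rewrite tyq.
have cw : c != w by apply: contraNneq wU => <-.
have W0 z t : 0 <= weights ty z t by apply: weight_ge0.
have P1 : 1 <= pot ty U w by apply: pot_ge1.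
have P0 : 0 <= pot ty U w by apply: le_trans P1.
have D0 z t : 0 <= del_edge (weights ty) p c z t.
  by rewrite /del_edge; case: ifP.
pose s1 := (b + 1) * i; pose s2 := (b ^+ 2 + 1) * i.
have s1_ge1 : 1 <= s1 by rewrite /s1 -(cap_arc1 w); apply: cap_ge1 => /=.
have s1a : s1 = s1 * i * a by rewrite -mulrA [i * a]mulrC ai mulr1.
pose ty0 := upd (upd ty p (Arc 1 y)) q (Arc 1 y').
have split3 : walks ty U w <= pathsum v (force_edge (weights ty) p c) U w +
    pathsum v (force_edge (weights ty) q c) U w + walks ty0 U w.
  have H1 := pathsum_edge v p c wU W0.
  have H2 := pathsum_edge v q c wU D0.
  (* Deleting p -> c before forcing q -> c only lowers weights. *)
  have H3 : pathsum v (force_edge (del_edge (weights ty) p c) q c) U w <=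
      pathsum v (force_edge (weights ty) q c) U w.
    apply: ler_pathsum => // [z t|z t _ _ _ _]; rewrite /force_edge /del_edge;
      by do !case: ifP => _.
  have H4 : pathsum v (del_edge (del_edge (weights ty) p c) q c) U w = walks ty0 U w.
    apply: eq_pathsum => // z t _ _ _ _; rewrite /del_edge /weights /ty0 /upd.
    case: (eqVneq z q) => [->|zq] /=.
      rewrite [q == p]eq_sym (negPf pq) /= tyq /=; case: (eqVneq t c) => [->|tc].
        by rewrite (negPf cy').
      by rewrite add0r.
    case: (eqVneq z p) => [->|zp] //=; rewrite typ /=.
    case: (eqVneq t c) => [->|tc]; first by rewrite (negPf cy).
    by rewrite add0r.
  by move: H1 H2 H3; rewrite /walks H4 -/(walks ty0 U w); lra.
have wf0 z : wf (ty0 z) by rewrite /ty0 /upd; do 2?case: ifP => _ /=.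
have ty0v : ty0 v = Sink.
  rewrite /ty0 /upd; case: eqP => [E|_]; first by rewrite -E tyv in tyq.
  by case: eqP => [E|_] //; rewrite -E tyv in typ.
have sz0 : (size_of ty0 U < n)%N.
  apply: leq_trans sn; rewrite /size_of ltn_add2l.
  apply: (@outsize_sum_lt q) => [z|]; rewrite /ty0 /upd.
    by case: eqP => [->|_]; [rewrite tyq|case: eqP => [->|_]; rewrite ?typ].
  by rewrite eqxx tyq.
have cap0 z : cap (ty0 z) <= cap (ty z).
  rewrite /ty0 /upd; case: eqP => [->|_].
    by rewrite tyq cap_arc1; apply: le_trans s1_le _.
  by case: eqP => [->|_] //; rewrite typ cap_arc1; apply: le_trans s1_le _.
have cap0p : cap (ty0 p) = s1 * i * a.
  by rewrite /ty0 /upd (negPf pq) eqxx cap_arc1.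
have cap0q : cap (ty0 q) = s1 * i * a by rewrite /ty0 /upd eqxx cap_arc1.
have capd x x' : ty x = Fork c x' -> cap (unlink c (ty x)) = s1 * i * a.
  by move=> ->; rewrite [unlink _ _]/= eqxx cap_arc1.
have [X Y] := excess_bounds b2.
case: (pickP (fun z => [&& z \in w |: U, z != p, z != q & points (ty z) c])) =>
    [z /and4P[zU zp zq zc]|none].
  pose g := bump z (s2 * i).
  have gp : g p = 1 by rewrite /g /bump eq_sym (negPf zp).
  have gq : g q = 1 by rewrite /g /bump eq_sym (negPf zq).
  have g1 x : x \notin w |: U -> 1 <= g x.
    by move=> xU; rewrite /g /bump; case: eqP => // xz; rewrite xz zU in xU.
  have Hg x : x \in w |: U -> cap (unlink c (ty x)) <= g x * cap (ty x).
    move=> xU; rewrite /g /bump; case: eqP => [->|_]; last first.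
      by rewrite mul1r cap_unlink.
    have zv : z != v by apply: contraTneq zc => ->; rewrite tyv.
    have [x1 [x2 tyz]] := full z zU zv.
    by rewrite tyz in zc *; apply: cap_unlink_fork.
  have := forks_force ih sn gd pU qU cU pc pq typ tyq (fun x xU _ _ => Hg x xU) gp gq g1.
  have qp : q != p by rewrite eq_sym.
  have := forks_force ih sn gd qU pU cU qc qp tyq typ (fun x xU _ _ => Hg x xU) gq gp g1.
  have le0 : walks ty0 U w <= s1 * i * (s1 * i) * pot ty U w.
    apply: (@le_trans _ _ (pot ty0 U w)); first exact: ih.
    have -> : s1 * i * (s1 * i) = \prod_x (bump p (s1 * i) x * bump q (s1 * i) x).
      by rewrite big_split /= !prod_bump.
    apply: pot_ratio => // x; rewrite /bump /capat.
    case: (boolP (x \in _)) => xU; last first.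
      have /negPf-> : x != p by apply: contraNneq xU => ->.
      have /negPf-> : x != q by apply: contraNneq xU => ->.
      by rewrite !mulr1.
    case: (eqVneq x p) => [->|xp]; first by rewrite (negPf pq) mulr1 cap0p typ.
    case: (eqVneq x q) => [->|xq]; first by rewrite mul1r cap0q tyq.
    by rewrite !mul1r.
  rewrite prod_bump -/s1 => le1 le2; move: split3 => /le_trans; apply.
  apply: (le_trans (lerD (lerD le2 le1) le0)).
  apply: le_trans (ler_piMl P0 X); rewrite le_eqVlt; apply/orP; left; apply/eqP.
  by rewrite /s1 /s2; ring.
have Hg x : x \in w |: U -> x != p -> x != q ->
    cap (unlink c (ty x)) <= 1 * cap (ty x).
  by move=> *; rewrite mul1r cap_unlink.
have := forks_force ih sn gd pU qU cU pc pq typ tyq Hg erefl erefl (fun _ _ => lexx _).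
have qp : q != p by rewrite eq_sym.
have := forks_force ih sn gd qU pU cU qc qp tyq typ (fun x xU xq xp => Hg x xU xp xq)
  erefl erefl (fun _ _ => lexx _).
rewrite big1 // mulr1 -/s1 => le1 le2.
have le0 : walks ty0 U w <= i * (s1 * i * (s1 * i)) * pot ty U w.
  rewrite /walks (pathsum_unreachable (a := c)) //; last first.
    move=> x xU xc xv; apply: weight_points; rewrite /ty0 /upd.
    case: eqP => [_|/eqP xq] //; case: eqP => [_|/eqP xp] //.
    by have := none x; rewrite /= xU xp xq /= => ->.
  (* If c = v is unreachable there is no path at all; otherwise c carries a Fork whose capacity
     leaves the potential. *)
  have [cv|cv] := eqVneq c v.
    have si0 : 0 <= s1 * i.
      by apply: mulr_ge0 (ltW i_gt0); apply: le_trans s1_ge1.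
    rewrite pathsum_notin //; last by rewrite cv !inE eqxx.
    exact: mulr_ge0 (mulr_ge0 (ltW i_gt0) (mulr_ge0 si0 si0)) P0.
  apply: (@le_trans _ _ (pot ty0 (U :\ c) w)).
    apply: ih; first by split=> //; rewrite inE (negPf wU) andbF.
    apply: leq_trans sz0; rewrite /size_of ltnS leq_add2r.
    by apply/subset_leq_card/subsetDl.
  have -> : i * (s1 * i * (s1 * i)) =
      \prod_x (bump c i x * (bump p (s1 * i) x * bump q (s1 * i) x)).
    by rewrite !big_split /= !prod_bump.
  apply: pot_ratio => // x; rewrite /bump /capat.
  case: (eqVneq x c) => [->|xc].
    rewrite !inE eqxx (negPf cw) /= cU [c == p]eq_sym [c == q]eq_sym.
    rewrite (negPf pc) (negPf qc) !mulr1.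
    have [x1 [x2 ->]] : exists x1 x2, ty c = Fork x1 x2.
      by apply: full => //; rewrite inE cU orbT.
    by rewrite /= mulrC ai.
  rewrite mul1r !inE xc /= -!in_setU1.
  case: (boolP (x \in _)) => xU; last first.
    have /negPf-> : x != p by apply: contraNneq xU => ->.
    have /negPf-> : x != q by apply: contraNneq xU => ->.
    by rewrite !mulr1.
  case: (eqVneq x p) => [->|xp]; first by rewrite (negPf pq) mulr1 cap0p typ.
  case: (eqVneq x q) => [->|xq]; first by rewrite mul1r cap0q tyq.
  by rewrite !mul1r.
move: split3 => /le_trans; apply.
apply: (le_trans (lerD (lerD le2 le1) le0)).
apply: le_trans (ler_piMl P0 Y); rewrite le_eqVlt; apply/orP; left; apply/eqP.
by rewrite /s1; ring.
Qed.

(** * Following the edges out of the current vertex *)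

Lemma walk_simple n ty U w x :
  bounded_below n -> (size_of ty U <= n)%N ->
  good ty U w ->
  x \in U -> walks ty (U :\ x) x <= (cap (ty w))^-1 * pot ty U w.
Proof.
move=> ih sn gd xU; have [wfty tyv wU] := gd.
rewrite -[X in X * _](prod_bump w); apply: (walk_bound ih sn gd xU) => [z zU||z].
- apply: cap_unlink_le => //; rewrite /bump; case: eqP => // zw.
  by rewrite -zw zU in wU.
- by rewrite /bump eqxx mulVf // gt_eqF // (lt_le_trans ltr01) ?cap_ge1.
by rewrite /bump in_setU1 negb_or => /andP[/negPf->].
Qed.

Lemma walk_loss n ty U w x z k :
  bounded_below n -> (size_of ty U <= n)%N ->
  good ty U w ->
  x \in U -> z \in U -> cap (unlink x (ty z)) <= k * cap (ty z) ->
  walks ty (U :\ x) x <= (cap (ty w))^-1 * k * pot ty U w.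
Proof.
move=> ih sn gd xU zU kz; have [wfty tyv wU] := gd.
have zw : z != w by apply: contraNneq wU => <-.
rewrite -[X in X * k](prod_bump w) -[X in _ * X * _](prod_bump z) -big_split /=.
apply: (walk_bound ih sn gd xU) => [t tU||t]; rewrite /bump.
- have /negPf-> : t != w by apply: contraNneq wU => <-.
  rewrite mul1r; case: eqP => [->|_] //; rewrite mul1r; exact: cap_unlink.
- rewrite eqxx eq_sym (negPf zw) mulr1 mulVf //.
  by rewrite gt_eqF // (lt_le_trans ltr01) ?cap_ge1.
rewrite in_setU1 negb_or => /andP[/negPf-> tU]; rewrite mul1r.
by case: eqP => // tz; rewrite tz zU in tU.
Qed.

Lemma pot_del ty U w x : (forall z, wf (ty z)) -> x \in U -> x != w ->
  pot ty (U :\ x) w <= (cap (ty x))^-1 * pot ty U w.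
Proof.
move=> wfty xU xw; rewrite -[X in X * _](prod_bump x).
apply: pot_ratio => // z; rewrite /bump /capat !inE.
have [->|zx] := eqVneq z x; last by rewrite mul1r.
by rewrite (negPf xw) xU /= mulVf // gt_eqF // (lt_le_trans ltr01) ?cap_ge1.
Qed.

Lemma pot_move ty U w x : (forall z, wf (ty z)) -> x \in U -> w \notin U ->
  pot ty (U :\ x) x <= (cap (ty w))^-1 * pot ty U w.
Proof.
move=> wfty xU wU; rewrite -[X in X * _](prod_bump w).
apply: pot_ratio => // z; rewrite /bump /capat setD1K // in_setU1.
have [->|zx] := eqVneq z w; last by rewrite mul1r.
by rewrite (negPf wU) /= mulVf // gt_eqF // (lt_le_trans ltr01) ?cap_ge1.
Qed.

(* Entering y makes x unreachable. *)
Lemma orphan_step n ty U w x y :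
  bounded_below n -> (size_of ty U <= n)%N ->
  good ty U w ->
  cap (ty w) = a -> x \in U -> y \in U -> x != y ->
  normalized ty U w -> (forall z, z \in U -> z != v -> ty z <> Sink) ->
  (forall z, z \in U -> ~~ points (ty z) x) ->
  b * walks ty (U :\ x) x + walks ty (U :\ y) y <= pot ty U w.
Proof.
move=> ih sn gd tyw xU yU xy nm nsink nox; have [wfty tyv wU] := gd.
have P1 : 1 <= pot ty U w by apply: pot_ge1.
have P0 : 0 <= pot ty U w by apply: le_trans P1.
have b0 : 0 <= b by apply: le_trans b_ge1.
have xw : x != w by apply: contraNneq wU => <-.
have wUx : w \notin U :\ x by rewrite inE (negPf wU) andbF.
have yUx : y \in U :\ x by rewrite !inE eq_sym xy.
have xUy : x \in U :\ y by rewrite !inE xy.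
have szx : (size_of ty (U :\ x) <= n)%N.
  by apply: leq_trans sn; rewrite leq_add2r; apply/subset_leq_card/subsetDl.
have Ey : walks ty (U :\ y) y = walks ty (U :\ x :\ y) y.
  rewrite /walks (pathsum_unreachable (a := x)) //.
  - by rewrite !setDDl setUC.
  - by rewrite !inE eqxx.
  move=> z; rewrite setD1K // => zU _ _; apply: weight_points; exact: nox.
have lex : walks ty (U :\ x) x <= i * pot ty U w.
  by have := walk_simple ih sn gd xU; rewrite tyw.
(* If x = v, the branch through y never reaches v and contributes 0. *)
have [xv|xv] := eqVneq x v.
  rewrite Ey /walks [X in _ + X]pathsum_notin.
  - rewrite addr0; apply: le_trans (ler_wpM2l b0 lex) _.
    by rewrite mulrA ler_piMl // -biE lerDl mulr_ge0 // ltW.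
  - by rewrite -xv eq_sym.
  - by rewrite -xv !inE eqxx andbF.
have ley : walks ty (U :\ y) y <= i * ((cap (ty x))^-1 * pot ty U w).
  have gdx : good ty (U :\ x) w by split.
  rewrite Ey; apply: le_trans (walk_simple ih szx gdx yUx) _.
  rewrite tyw ler_pM2l //; exact: pot_del.
have Cx : 0 < cap (ty x) by rewrite (lt_le_trans ltr01) ?cap_ge1.
case tyx : (ty x) => [|k t|t t'].
- by have := nsink x xU xv.
(* Following the edge of x as well, both branches save the capacities of w and x. The total ratio (b
   * k + 1) / (a * cap (ty x)) is at most 1 by the second term of [cap]. *)
- have k1 : 1 <= k by have := wfty x; rewrite tyx.
  have k0 : 0 <= k by apply: le_trans k1.
  have /andP[tx tU] : (t != x) && (t \in U).
    by apply: nm; rewrite ?tyx /= ?in_setU1 ?xU ?orbT.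
  have tUx : t \in U :\ x by rewrite !inE tx.
  have gdx : good ty (U :\ x) x by split; rewrite ?inE ?eqxx.
  have lex' : walks ty (U :\ x) x <= k * ((cap (ty x))^-1 * (i * pot ty U w)).
    rewrite {1}/walks pathsum_step // (big_setD1 t) //= [X in _ + X]big1; last first.
      move=> s; rewrite !inE /weights tyx /= => /andP[/negPf-> _].
      by rewrite mul0r.
    rewrite addr0 {1}/weights tyx /= eqxx mulr1n; apply: ler_wpM2l => //.
    rewrite -[X in _ <= X * _]/(cap (Arc k t))^-1 -tyx.
    apply: le_trans (walk_simple ih szx gdx tUx) _.
    rewrite ler_pM2l ?invr_gt0 //; have := pot_move wfty xU wU.
    by rewrite tyw.
  apply: (le_trans (lerD (ler_wpM2l b0 lex') ley)).
  have -> : b * (k * ((cap (ty x))^-1 * (i * pot ty U w))) +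
      i * ((cap (ty x))^-1 * pot ty U w) =
      (b * k + 1) * i / cap (ty x) * pot ty U w by ring.
  rewrite ler_piMl // ler_pdivrMr // mul1r ler_pdivrMr // tyx [leRHS]mulrC.
  by case: (cap_arc_lb k t).
apply: (le_trans (lerD (ler_wpM2l b0 lex) ley)).
have -> : (cap (ty x))^-1 = i by rewrite tyx.
have -> : b * (i * pot ty U w) + i * (i * pot ty U w) = (b * i + i * i) * pot ty U w.
  by ring.
by rewrite biE mul1r.
Qed.

Lemma walk_fork ty U w x y : good ty U w -> w != v -> ty w = Fork x y ->
  x \in U -> y \in U ->
  walks ty U w = b * walks ty (U :\ x) x + walks ty (U :\ y) y.
Proof.
move=> [wfty tyv wU] wv tyw xU yU; have xy : x != y by have := wfty w; rewrite tyw.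
have yx : y \in U :\ x by rewrite !inE eq_sym xy.
rewrite /walks pathsum_step // (big_setD1 x) //= (big_setD1 y) //= big1.
  rewrite addr0 {1 3}/weights tyw /= !eqxx [y == x]eq_sym (negPf xy).
  by rewrite !mulr0n mulr1n addr0 add0r mul1r.
move=> t; rewrite !inE /weights tyw /= => /and3P[/negPf-> /negPf-> _].
by rewrite addr0 mul0r.
Qed.

(** Distinct heavy targets make y the heavy target of some row q, which loses its heavy edge when y
    is entered. If no row points to x, [orphan_step] applies; otherwise entering x costs a row an
    edge too. *)
Lemma bijection_step n ty U w :
  bounded_below n -> (size_of ty U <= n)%N ->
  good ty U w -> w != v -> v \in U -> normalized ty U w ->
  (forall z, z \in w |: U -> z != v -> exists x x', ty z = Fork x x') ->
  (forall p q c y y', p \in w |: U -> q \in w |: U ->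
     ty p = Fork c y -> ty q = Fork c y' -> p = q) ->
  walks ty U w <= pot ty U w.
Proof.
move=> ih sn gd wv vU nm full noexc; have [wfty tyv wU] := gd.
have [x [y tyw]] := full w (setU11 _ _) wv.
have xy : x != y by have := wfty w; rewrite tyw.
have P1 : 1 <= pot ty U w by apply: pot_ge1.
have P0 : 0 <= pot ty U w by apply: le_trans P1.
have b0 : 0 <= b by apply: le_trans b_ge1.
have /andP[_ xU] : (x != w) && (x \in U).
  by apply: nm; rewrite ?setU11 // tyw /= eqxx.
have /andP[_ yU] : (y != w) && (y \in U).
  by apply: nm; rewrite ?setU11 // tyw /= eqxx orbT.
have capw : cap (ty w) = a by rewrite tyw.
rewrite (walk_fork gd wv tyw) //.
have [z /andP[zU zx]|none] := pickP (fun z => (z \in U) && points (ty z) x); last first.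
  apply: (orphan_step ih) => // [z zU zv E|z zU].
    by have [|x1 [x2]] := full z _ zv; rewrite ?E // in_setU1 zU orbT.
  by have := none z; rewrite zU /= => ->.
pose h t := if ty t is Fork t' _ then t' else t.
pose S := (w |: U) :\ v.
have hS t : t \in S -> exists t', ty t = Fork (h t) t'.
  rewrite in_setD1 => /andP[tv tU]; have [t1 [t2 E]] := full t tU tv.
  by exists t2; rewrite /h E.
have hSU : h @: S = U.
  apply/eqP; rewrite eqEcard; apply/andP; split.
    apply/subsetP => _ /imsetP[t tS ->]; have [t' E] := hS t tS.
    have /andP[_] // : (h t != t) && (h t \in U).
    apply: nm; last by rewrite E /= eqxx.
    by move: tS; rewrite in_setD1 => /andP[].
  (* S trades v for w, so it has as many vertices as U and the injective h is onto U. *)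
  rewrite card_in_imset.
    have := cardsD1 v (w |: U); rewrite cardsU1 wU inE vU orbT -/S.
    by rewrite !add1n => -[->].
  move=> p q pS qS hpq; have [p' Ep] := hS p pS; have [q' Eq] := hS q qS.
  rewrite -hpq in Eq; apply: noexc Ep Eq.
    by move: pS; rewrite in_setD1 => /andP[].
  by move: qS; rewrite in_setD1 => /andP[].
have [q qS yE] : exists2 q, q \in S & y = h q by apply/imsetP; rewrite hSU.
have [q' tyq] := hS q qS; rewrite -yE in tyq.
have qU : q \in U.
  move: qS; rewrite !inE => /andP[_ /orP[/eqP qw|//]].
  by rewrite qw tyw in tyq; case: tyq => E _; rewrite E eqxx in xy.
have zv : z != v by apply: contraTneq zx => ->; rewrite tyv.
have kz : cap (unlink x (ty z)) <= (b ^+ 2 + 1) * i * i * cap (ty z).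
  have [|x1 [x2 tyz]] := full z _ zv; first by rewrite in_setU1 zU orbT.
  by rewrite tyz in zx *; apply: cap_unlink_fork.
have kq : cap (unlink y (ty q)) <= (b + 1) * i * i * cap (ty q).
  by rewrite tyq [unlink _ _]/= eqxx cap_arc1 -mulrA [i * _]mulrC ai mulr1.
have lex := walk_loss ih sn gd xU zU kz.
have ley := walk_loss ih sn gd yU qU kq.
apply: (le_trans (lerD (ler_wpM2l b0 lex) ley)).
rewrite capw -/i mulrA -mulrDl ler_piMl //.
have I0 := i_gt0; pose B := b * i.
have -> : b * (i * ((b ^+ 2 + 1) * i * i)) + i * ((b + 1) * i * i) =
   B * B * B + 2 * B * (i * i) + i * i * i by rewrite /B; ring.
(* With this value the sum of ratios is 1 minus the product shown nonnegative below; i <= B settles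
   its sign. *)
have BE : B = 1 - i * i by rewrite -biE /B; ring.
have iB : i <= B by rewrite /B ler_peMl // ltW.
have : 0 <= i * i * (1 - i * i - i + i * i * (i * i)).
  rewrite mulr_ge0 ?mulr_ge0 ?(ltW I0) // addr_ge0 ?mulr_ge0 ?(ltW I0) //.
  by rewrite subr_ge0 -BE.
by rewrite BE; lra.
Qed.

(** Either a target is orphaned, or each branch saves the capacity a of w and costs another row a
    factor a / 2, so that each has ratio 1 / 2. *)
Lemma golden_step n ty U w x y : b = 1 -> bounded_below n -> (size_of ty U <= n)%N ->
  good ty U w -> w != v -> normalized ty U w ->
  (forall z, z \in U -> z != v -> ty z <> Sink) ->
  ty w = Fork x y -> walks ty U w <= pot ty U w.
Proof.
move=> b1 ih sn gd wv nm nsink tyw; have [wfty tyv wU] := gd.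
have xy : x != y by have := wfty w; rewrite tyw.
have P1 : 1 <= pot ty U w by apply: pot_ge1.
have P0 : 0 <= pot ty U w by apply: le_trans P1.
have /andP[_ xU] : (x != w) && (x \in U).
  by apply: nm; rewrite ?setU11 // tyw /= eqxx.
have /andP[_ yU] : (y != w) && (y \in U).
  by apply: nm; rewrite ?setU11 // tyw /= eqxx orbT.
have capw : cap (ty w) = a by rewrite tyw.
rewrite (walk_fork gd wv tyw) //.
have [z /andP[zU zx]|nox] := pickP (fun z => (z \in U) && points (ty z) x); last first.
  apply: (orphan_step ih) => // z zU.
  by have := nox z; rewrite zU /= => ->.
have [q /andP[qU qy]|noy] := pickP (fun z => (z \in U) && points (ty z) y); last first.
  (* Both edges weigh 1, so x and y can exchange roles. *)
  rewrite addrC b1 mul1r -[X in X + _]mul1r -b1.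
  apply: (orphan_step ih) => // [|q qU]; first by rewrite eq_sym.
  by have := noy q; rewrite qU /= => ->.
have loss p t : points (ty p) t -> cap (unlink t (ty p)) <= a / 2 * cap (ty p).
  move: (wfty p); case: (ty p) => [|k s|s s'] // k1 ts.
    have k1' : 1 <= k := k1; rewrite (eqP ts) [unlink _ _]/= eqxx [cap Sink]/=.
    have [_] := cap_arc_lb k s; set C := cap _; rewrite b1; lra.
  apply: le_trans (cap_unlink_fork ts) _; rewrite ler_pM2r //.
  (* For a Fork the claim 2 * (i * i) <= a / 2 becomes 4 - 2 * a <= a / 2, that is 8 / 5 <= a. *)
  have : 8 / 5 <= a.
    by rewrite leNgt; apply/negP => H; move: aE a_gt0; rewrite b1; nra.
  have E : i * i = 1 - i by rewrite -biE b1; ring.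
  by rewrite -mulrA E b1 iE b1; lra.
have lex := walk_loss ih sn gd xU zU (loss _ _ zx).
have ley := walk_loss ih sn gd yU qU (loss _ _ qy).
rewrite b1 mul1r; apply: (le_trans (lerD lex ley)).
by rewrite capw mulrA mulVf ?gt_eqF // -mulrDl -splitr mul1r.
Qed.

(** The alternatives for b are the values k - 1 for integers k >= 2. Each case of the induction
    excludes a configuration that the later step lemmas assume absent. *)
Theorem walks_le_pot ty U w : b = 1 \/ b = 2 \/ 3 <= b ->
  good ty U w -> walks ty U w <= pot ty U w.
Proof.
move=> bH; have [n] := ubnP (size_of ty U).
elim: n ty U w => // n ih ty U w; rewrite ltnS => sn gd.
have {}ih : bounded_below n by move=> ty' U' w' gd' lt'; apply: ih.
have [wfty tyv wU] := gd.
have [->|wv] := eqVneq w v; first exact: walks_end.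
have P0 : 0 <= pot ty U w by apply: le_trans (pot_ge1 _ _ _).
have [[z t] /= /and3P[zU zt tz]|nrm] := pickP (fun zt : V * V =>
    [&& zt.1 \in w |: U, points (ty zt.1) zt.2 &
        (zt.2 == zt.1) || (zt.2 \notin U)]).
  exact: normalize ih sn gd zt tz.
have nm : normalized ty U w.
  move=> z t zU zt; have := nrm (z, t); rewrite /= zU zt /= => /negbT.
  by rewrite negb_or negbK.
have [p /and3P[pU pv /eqP tp]|ns] := pickP (fun p =>
    [&& p \in U, p != v & outsize (ty p) == 0%N]).
  apply: (sink_step ih sn gd pU pv); by move: tp; case: (ty p).
have nsink z : z \in U -> z != v -> ty z <> Sink.
  by move=> zU zv E; have := ns z; rewrite zU zv E.
have [vU|vU] := boolP (v \in U); last by rewrite /walks pathsum_notin.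
case tyw : (ty w) => [|k x|x y].
- by rewrite /walks pathsum_step // big1 // => t _; rewrite /weights tyw mul0r.
- have /andP[_ xU] : (x != w) && (x \in U).
    by apply: nm; rewrite ?setU11 // tyw /= eqxx.
  exact: (arc_step ih sn gd wv tyw xU).
case: bH => [b1|b23]; first exact: (golden_step b1 ih sn gd wv nm nsink tyw).
have [p /andP[pU tp]|noarc] := pickP (fun p => (p \in U) && (outsize (ty p) == 1%N)).
  case typ : (ty p) tp => [|k d|//] // _.
  have /andP[dp dU] : (d != p) && (d \in U).
    by apply: nm; rewrite ?in_setU1 ?pU ?orbT // typ /= eqxx.
  have pd : p != d by rewrite eq_sym.
  pose dbl z := [&& z \in w |: U, points (ty z) p & points (ty z) d].
  have [q /and3P[qU qp qd]|nod] := pickP dbl; last first.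
    (* No row has both targets, so any row other than p can serve as q. *)
    apply: (contract_step (q := w) ih sn gd pU dU pd typ) => [|z zU zpd].
      by apply: contraNneq wU => ->.
    by have := nod z; rewrite /dbl zU zpd.
  have [q' /andP[qq' /and3P[q'U q'p q'd]]|noq'] := pickP (fun z => (q != z) && dbl z).
    have b2 : 2 <= b by case: b23; lra.
    exact: (double_step b2 ih sn gd pU dU pd typ qU q'U).
  apply: (contract_step (q := q) ih sn gd pU dU pd typ) => [|z zU zpd].
    by apply: contraTneq qp => ->; rewrite typ.
  by apply/eqP; have := noq' z; rewrite /dbl zU zpd /= andbT eq_sym => /negbFE.
have full z : z \in w |: U -> z != v -> exists x x', ty z = Fork x x'.
  rewrite in_setU1 => /orP[/eqP->|zU] zv; first by exists x, y.
  case tyz : (ty z) => [|k t|t t']; last by exists t, t'.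
    by have := nsink z zU zv; rewrite tyz.
  by have := noarc z; rewrite zU tyz.
pose heavy z := if ty z is Fork t _ then Some t else None.
have [[p q] /= /and5P[pU qU pq /eqP hpq hp]|noexc] := pickP (fun pq : V * V =>
    [&& pq.1 \in w |: U, pq.2 \in w |: U, pq.1 != pq.2,
        heavy pq.1 == heavy pq.2 & heavy pq.1 != None]).
  move: hpq hp; rewrite /heavy; case typ : (ty p) => [|//|c t] //.
  case tyq : (ty q) => [|//|c' t'] // [cc'] _; rewrite -cc' in tyq.
  exact: (excess_step b23 ih sn gd wv nm full pU qU pq typ tyq).
apply: (bijection_step ih sn gd wv vU nm full) => p q c t t' pU qU typ tyq.
have := noexc (p, q); rewrite /= pU qU /heavy typ tyq eqxx /= !andbT.
by move/negbFE/eqP.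
Qed.

End Capacity.

(** * Reduction of arbitrary rows to Forks *)

Section ExtremalRows.
Variables (R : realFieldType) (V : finType) (v : V) (b : R).
Hypothesis b_ge0 : 0 <= b.
Implicit Types (A : V -> V -> R) (U : {set V}) (w q : V).

(** A linear form with nonnegative coefficients, on rows with entries at most b and sum at most b +
    1, is largest with b on the greatest coefficient and 1 on the second greatest. *)
Lemma extremal_row A U w q : (1 < #|V|)%N -> w \notin U ->
  (forall z t, 0 <= A z t) -> (forall t, A q t <= b) ->
  \sum_t A q t <= b + 1 ->
  exists x y, x != y /\
    pathsum v A U w <= pathsum v (set_row A q (row_weight b (Fork x y))) U w.
Proof.
move=> V2 wU A0 Ab Asum.
pose f r := pathsum v (set_row A q r) U w.
pose Q t := f (fun x => (x == t)%:R) - f (fun=> 0).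
have Q0 t : 0 <= Q t.
  rewrite subr_ge0; apply: ler_pathsum => // z s; rewrite /set_row.
    by case: ifP.
  by move=> _ _ _ _; case: ifP => // _; apply: ler0n.
have fE r : f r = f (fun=> 0) + \sum_t r t * Q t by apply: pathsum_row_affine.
have [x _ xmax] := arg_maxP Q (isT : xpredT q).
have [y0 y0x] : exists y0, y0 != x.
  apply/existsP; rewrite -negb_forall; apply: contraTN V2 => /forallP H.
  by rewrite -leqNgt (@eq_card1 _ x) // => t; rewrite !inE (eqP (H t)) eqxx.
have [y yx ymax] := @arg_maxP _ _ _ y0 (fun t => t != x) Q y0x.
exists x, y; split; first by rewrite eq_sym.
have -> : pathsum v A U w = f (A q).
  by apply: eq_pathsum => // z t _ _ _ _; rewrite /set_row; case: eqP => [->|].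
rewrite -/(f (row_weight b (Fork x y))) (fE (A q)) (fE (row_weight _ _)) lerD2l.
have -> : \sum_t row_weight b (Fork x y) t * Q t = b * Q x + Q y.
  rewrite (bigD1 x) //= (bigD1 y) //= big1.
    rewrite !eqxx [x == y]eq_sym (negPf yx) !mulr0n !mulr1n.
    by rewrite !addr0 add0r mul1r.
  by move=> t /andP[/negPf-> /negPf->]; rewrite addr0 mul0r.
rewrite (bigD1 x) //= in Asum; rewrite [leLHS](bigD1 x) //=.
have le1 : \sum_(t | t != x) A q t * Q t <= (\sum_(t | t != x) A q t) * Q y.
  rewrite mulr_suml; apply: ler_sum => t tx; apply: ler_wpM2l => //.
  exact: ymax.
have le2 : (\sum_(t | t != x) A q t) * Q y <= (b + 1 - A q x) * Q y.
  by apply: ler_wpM2r => //; rewrite lerBrDl.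
have Qyx : Q y <= Q x by apply: xmax.
(* This product is the gain of the Fork over the bound from [le1] and [le2]. *)
have : 0 <= (b - A q x) * (Q x - Q y) by rewrite mulr_ge0 ?subr_ge0.
by move: le1 le2; lra.
Qed.

Lemma extremal_rows A U w (s : seq V) : (1 < #|V|)%N -> w \notin U ->
  (forall z t, 0 <= A z t <= b) -> (forall z, \sum_t A z t <= b + 1) ->
  exists h : V -> V * V, (forall z, (h z).1 != (h z).2) /\
    pathsum v A U w <= pathsum v (fun z => if z \in s
      then row_weight b (Fork (h z).1 (h z).2) else A z) U w.
Proof.
move=> V2 wU Ab Asum; elim: s => [|q s [h [hne le]]].
  have [x [y [xy _]]] : exists x y : V, x != y /\ True.
    have /card_gt1P[x [y [_ _ xy]]] : (1 < #|[pred x : V | true]|)%N by [].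
    by exists x, y.
  by exists (fun=> (x, y)); split.
have [qs|qs] := boolP (q \in s).
  exists h; split=> //; apply: (le_trans le).
  rewrite le_eqVlt; apply/orP; left; apply/eqP.
  apply: eq_pathsum => // z t _ _ _ _; rewrite inE.
  by case: eqP => [->|] //=; rewrite qs.
pose B z := if z \in s then row_weight b (Fork (h z).1 (h z).2) else A z.
have B0 z t : 0 <= B z t.
  rewrite /B; case: ifP => _; last by case/andP: (Ab z t).
  by rewrite /= addr_ge0 ?mulrn_wge0.
have Bq : B q = A q by rewrite /B (negPf qs).
have [||x [y [xy le']]] := @extremal_row B U w q V2 wU B0.
- by rewrite Bq => t; case/andP: (Ab q t).
- by rewrite Bq.
exists (fun z => if z == q then (x, y) else h z); split.
  by move=> z; case: ifP.
apply: (le_trans le); apply: (le_trans le').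
rewrite le_eqVlt; apply/orP; left; apply/eqP.
apply: eq_pathsum => // z t _ _ _ _; rewrite /set_row inE /B.
by case: eqP.
Qed.

(** Every row becomes a Fork except that of v, which no path leaves and which becomes a Sink; hence
    the exponent |V| - 1. *)
Theorem pathsum_le_pow (a : R) A U w : b = 1 \/ b = 2 \/ 3 <= b ->
  0 < a -> a * a = b * a + 1 -> w \notin U ->
  (forall z t, 0 <= A z t <= b) -> (forall z, \sum_t A z t <= b + 1) ->
  pathsum v A U w <= a ^+ #|V|.-1.
Proof.
move=> bH a0 aE wU Ab Asum.
have b1 : 1 <= b by case: bH => [->|[->|]] //; lra.
have a1 : 1 <= a by rewrite leNgt; apply/negP => H; nra.
have [->|wv] := eqVneq w v; first by rewrite pathsum_end exprn_ege1.
have V2 : (1 < #|V|)%N by apply/card_gt1P; exists w, v.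
have [h [hne le]] := @extremal_rows A U w (enum V) V2 wU Ab Asum.
apply: (le_trans le); pose ty := upd (fun z => Fork (h z).1 (h z).2 : outrow R V) v Sink.
have -> : pathsum v (fun z => if z \in enum V then
    row_weight b (Fork (h z).1 (h z).2) else A z) U w = walks v b ty U w.
  apply: eq_pathsum => // z t _ _ _ zv; rewrite mem_enum inE.
  by rewrite /weights /ty /upd (negPf zv).
have gd : good v ty U w.
  split=> //; last by rewrite /ty /upd eqxx.
  by move=> z; rewrite /ty /upd; case: ifP => //= _; apply: hne.
apply: (le_trans (walks_le_pot b1 a0 aE bH gd)).
have -> : a ^+ #|V|.-1 = \prod_z (if z != v then a else 1).
  by rewrite -big_mkcond /= big_const iter_mulr_1 (cardC1 v).
apply: ler_prod => z _; have [wfty _ _] := gd.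
rewrite (le_trans ler01 (capat_ge1 b1 a0 aE _ (wfty z))) /=.
rewrite /capat /ty /upd; case: eqP => _ /=; case: ifP => //=.
Qed.

End ExtremalRows.

From mathcomp Require Import all_classical all_reals all_analysis.
Import Order.TTheory GRing.Theory Num.Theory.

(** * Bregman's bound *)

Section Bregman.
Variables (R : realType) (V : finType).
Implicit Types (E : rel V) (D : {set V}) (s : {perm V}) (i j z t : V).

(** Its cardinality is the permanent of the 0-1 matrix of E. *)
Definition perms_in E : {set {perm V}} := [set s : {perm V} | [forall z, E z (s z)]].
Definition outdegree E z := #|[pred t | E z t]|.
(* [logfact 0 = 0] since division by 0 gives 0. *)
Definition logfact (r : nat) : R := ln (r`!%:R) / r%:R.
(* Fixes the value j at i; the set of vertices never changes, and [frozen] rows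
   play the role of deleted rows and columns. *)
Definition freeze E i j : rel V :=
  fun z t => if z == i then t == j else (t != j) && E z t.

Lemma logfact_ge0 r : 0 <= logfact r.
Proof. by rewrite /logfact divr_ge0 // ln_ge0 // ler1n fact_gt0. Qed.

Lemma logfact1 : logfact 1 = 0.
Proof. by rewrite /logfact ln1 mul0r. Qed.

Lemma logfact_mul r : r%:R * logfact r = ln (r`!%:R).
Proof.
case: r => [|r]; first by rewrite mul0r ln1.
by rewrite /logfact mulrC divfK // pnatr_eq0.
Qed.

Lemma fact_le_exp m N : (m <= N)%N -> (m`! <= N ^ m)%N.
Proof.
by elim: m => // m IHm mN; rewrite factS expnS leq_mul ?IHm // ltnW.
Qed.

(** For r > 0 this amounts to r! <= (r + 1)^r. *)
Lemma logfactS r : logfact r <= logfact r.+1.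
Proof.
case: r => [|r]; first by rewrite logfact1 /logfact invr0 mulr0.
rewrite /logfact ler_pdivrMr ?ltr0n // mulrAC ler_pdivlMr ?ltr0n //.
rewrite [in leRHS]factS natrM lnM ?posrE ?ltr0n ?fact_gt0 //.
have : ln (r.+1`!%:R : R) <= r.+1%:R * ln (r.+2%:R).
  rewrite mulr_natl -lnXn ?ltr0n // ler_ln ?posrE ?exprn_gt0 ?ltr0n ?fact_gt0 //.
  by rewrite -natrX ler_nat fact_le_exp.
move: (ln r.+2%:R) (ln _) => M L; rewrite -[in X in _ -> X](natr1 r.+1).
by move: (r.+1%:R) => x H; lra.
Qed.

Lemma logfact_le r r' : (r <= r')%N -> logfact r <= logfact r'.
Proof.
move/subnK <-; elim: (r' - r)%N => // m IHm; rewrite addSn.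
exact: le_trans IHm (logfactS _).
Qed.

(* Convexity of x ln x, from ln y <= y - 1. *)
Lemma log_sum (I : finType) (P : pred I) (x : I -> nat) (X : nat) :
  X = (\sum_(j | P j) x j)%N ->
  X%:R * ln (X%:R) <= X%:R * ln (#|P|%:R) +
     \sum_(j | P j) (x j)%:R * ln ((x j)%:R) :> R.
Proof.
move=> XE; have [X0|X0] := eqVneq X 0%N.
  rewrite X0 !mul0r add0r; apply: sumr_ge0 => j _.
  case: (x j) => [|m]; first by rewrite mul0r.
  by rewrite mulr_ge0 // ln_ge0 // ler1n.
have Xp : 0 < X%:R :> R by rewrite ltr0n lt0n.
have Pp : 0 < #|P|%:R :> R.
  rewrite ltr0n lt0n; apply: contra_neq X0 => P0; rewrite XE big1 // => j Pj.
  by have := card0_eq P0 j; rewrite unfold_in Pj.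
(* Apply ln y <= y - 1 to y = X / (|P| * x j) termwise; the right sides sum to 0. *)
have key : \sum_(j | P j) (x j)%:R * (ln (X%:R) - ln (#|P|%:R) - ln ((x j)%:R))
    <= \sum_(j | P j) (X%:R / #|P|%:R - (x j)%:R) :> R.
  apply: ler_sum => j Pj; case E : (x j) => [|m].
    by rewrite mul0r subr0 divr_ge0.
  have mp : 0 < m.+1%:R :> R by rewrite ltr0n.
  rewrite -ln_div ?posrE // -ln_div ?posrE ?divr_gt0 //.
  have -> : X%:R / #|P|%:R - m.+1%:R =
      m.+1%:R * (X%:R / #|P|%:R / m.+1%:R - 1) :> R.
    by rewrite mulrBr mulr1 mulrCA mulfV ?mulr1 // pnatr_eq0.
  rewrite ler_pM2l //; set y := _ / _ / _.
  by have := @le_ln1Dx R (y - 1); rewrite [1 + _]addrC subrK; apply; rewrite ltrBrDr addNr !divr_gt0.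
move: key; rewrite sumrB sumr_const -natr_sum -XE.
rewrite -[X in _ <= X - _ -> _]mulr_natr divfK ?gt_eqF // subrr.
under eq_bigr => j _ do rewrite mulrBr.
rewrite sumrB -mulr_suml -natr_sum -XE; lra.
Qed.

Lemma freeze_perms E i j : E i j ->
  perms_in (freeze E i j) = [set s in perms_in E | s i == j].
Proof.
move=> Eij; apply/setP => s; rewrite !inE; apply/forallP/andP => [H|[/forallP H /eqP sij] z].
  have sij : s i == j by have := H i; rewrite /freeze eqxx.
  split=> //; apply/forallP => z; have := H z; rewrite /freeze.
  by case: eqP => [->|_ /andP[]//]; rewrite (eqP sij).
rewrite /freeze; case: eqP => [->|/eqP zi]; first by rewrite sij.
by rewrite H andbT -sij (inj_eq perm_inj).
Qed.

Lemma card_split E i :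
  #|perms_in E| = (\sum_(j | E i j) #|perms_in (freeze E i j)|)%N.
Proof.
rewrite -sum1_card (partition_big (fun s : {perm V} => s i) (E i)) /=; last first.
  by move=> s; rewrite inE => /forallP.
apply: eq_bigr => j Eij; rewrite freeze_perms // -sum1_card.
by apply: eq_bigl => s; rewrite !inE.
Qed.

(** The counts produced by [log_sum] become a sum over permutations, which makes the sums over i and
    over s exchangeable. *)
Lemma sum_split E i (F : V -> R) :
  \sum_(s in perms_in E) F (s i) =
  \sum_(j | E i j) #|perms_in (freeze E i j)|%:R * F j.
Proof.
rewrite (partition_big (fun s : {perm V} => s i) (E i)) /=; last first.
  by move=> s; rewrite inE => /forallP.
apply: eq_bigr => j Eij; rewrite freeze_perms // mulr_natl -sumr_const.
rewrite [RHS](eq_bigl (fun s => (s \in perms_in E) && (s i == j))); last first.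
  by move=> s; rewrite !inE.
by apply: eq_bigr => s /andP[_ /eqP->].
Qed.

Definition frozen E i := exists c, E i =1 pred1 c /\ forall j, E j c -> j = i.

Lemma freeze_row E i z s : s \in perms_in E -> z != i ->
  (outdegree (freeze E i (s i)) z + E z (s i) = outdegree E z)%N.
Proof.
move=> sE zi; rewrite addnC /outdegree [RHS](cardD1 (s i)) inE; congr (_ + _)%N.
by apply: eq_card => t; rewrite !inE /freeze (negPf zi).
Qed.

(** Expand along each i in D and add up. For a fixed s and a row z in D with r targets, s i is a
    target of z for r choices of i. One is i = z, giving 0; r - 1 give [logfact] of r - 1, and the
    other |D| - r give [logfact] of r. With ln r this makes |D| times [logfact] of r, as ln r + ln
    (r - 1)! = ln r!. *)
Lemma bregman_frozen D E : (forall i, i \notin D -> frozen E i) ->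
  ln (#|perms_in E|%:R) <= \sum_z logfact (outdegree E z) :> R.
Proof.
have [m] := ubnP #|D|; elim: m D E => // m IHm D E Dm fr.
have S0 : 0 <= \sum_z logfact (outdegree E z) by apply: sumr_ge0 => *; apply: logfact_ge0.
(* Without permutations the left side is ln 0, which is 0 by convention. *)
have [P0|P0] := eqVneq #|perms_in E| 0%N; first by rewrite P0 ln0.
have Pp : 0 < #|perms_in E|%:R :> R by rewrite ltr0n lt0n.
have [D0|D0] := eqVneq #|D| 0%N.
  suff -> : #|perms_in E| = 1%N by rewrite ln1.
  apply/eqP; rewrite eqn_leq lt0n P0 andbT; apply/card_le1_eqP => s t.
  rewrite !inE => /forallP sE /forallP tE; apply/permP => z.
  have [|c [Ez _]] := fr z; first by rewrite (cards0_eq (eqP (introT eqP D0))) inE.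
  by have := sE z; have := tE z; rewrite !Ez => /eqP-> /eqP->.
have Dp : 0 < #|D|%:R :> R by rewrite ltr0n lt0n.
have outfr z : z \notin D -> outdegree E z = 1%N.
  by move=> zD; have [c [Ez _]] := fr z zD; rewrite -(card1 c); apply: eq_card.
rewrite -(ler_pM2l (mulr_gt0 Dp Pp)).
have step i : i \in D ->
    #|perms_in E|%:R * ln (#|perms_in E|%:R) <=
    \sum_(s in perms_in E) (ln ((outdegree E i)%:R) +
       \sum_z logfact (outdegree (freeze E i (s i)) z)) :> R.
  move=> iD; have := @log_sum V (E i) (fun j => #|perms_in (freeze E i j)|) _ (card_split E i).
  move=> /le_trans; apply.
  rewrite big_split /= sumr_const mulr_natl lerD2l.
  rewrite -(sum_split E i (fun j => ln (#|perms_in (freeze E i j)|%:R))).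
  apply: ler_sum => s sE; apply: (IHm (D :\ i)).
    by move: Dm; rewrite (cardsD1 i) iD.
  move=> z; rewrite in_setD1 negb_and negbK => zD.
  have [zi|zi] := eqVneq z i.
    exists (s i); rewrite zi; split=> [t|j]; rewrite /freeze ?eqxx //.
    by case: eqP => // _; rewrite eqxx.
  move: zD; rewrite (negPf zi) /= => zD; have [c [Ez Ec]] := fr z zD.
  have szc : s z = c.
    by move: sE; rewrite inE => /forallP/(_ z); rewrite Ez => /eqP.
  (* Since s is injective, freezing s i at i leaves row z frozen at c. *)
  have cs : c != s i by rewrite -szc (inj_eq perm_inj).
  exists c; split=> [t|j]; rewrite /freeze.
    rewrite (negPf zi) Ez /=; case: (eqVneq t c) => [->|]; rewrite ?cs ?andbF //.
  case: eqP => [_|_ /andP[_ /Ec]//]; by rewrite (negPf cs).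
have -> : #|D|%:R * #|perms_in E|%:R * ln (#|perms_in E|%:R) =
    \sum_(i in D) #|perms_in E|%:R * ln (#|perms_in E|%:R) :> R.
  by rewrite sumr_const -mulrA mulr_natl.
apply: (le_trans (ler_sum _ step)); rewrite exchange_big /=.
rewrite -mulrA mulrCA mulr_natl -sumr_const; apply: ler_sum => s sE.
have sEz z : E z (s z) by move: sE; rewrite inE => /forallP/(_ z).
have Dsum F : (forall z, z \notin D -> F z = 0) -> \sum_z F z = \sum_(z in D) F z :> R.
  by move=> F0; rewrite [RHS]big_mkcond; apply: eq_bigr => z _; case: ifP => // /negbT/F0.
rewrite (Dsum (fun z => logfact (outdegree E z))); last first.
  by move=> z zD; rewrite outfr // logfact1.
rewrite big_split /= mulr_sumr.
(* The last term cancels the contribution of z = i, whose row now has one target and [logfact] 0. *)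
have Ei i : i \in D -> \sum_z logfact (outdegree (freeze E i (s i)) z) =
    \sum_(z in D) (logfact (outdegree E z) + (E z (s i))%:R *
      (logfact (outdegree E z).-1 - logfact (outdegree E z)) -
      (z == i)%:R * logfact (outdegree E z).-1) :> R.
  move=> iD; rewrite Dsum => [|z zD].
    apply: eq_bigr => z zD; have [->|zi] := eqVneq z i.
      have -> : outdegree (freeze E i (s i)) i = 1%N.
        by rewrite -(card1 (s i)); apply: eq_card => t; rewrite !inE /freeze eqxx.
      by rewrite logfact1 sEz ?eqxx /=; ring.
    rewrite mul0r subr0 -(freeze_row sE zi); case: (E z (s i)).
      by rewrite addn1 mul1r addrC subrK.
    by rewrite addn0 mul0r addr0.
  have zi : z != i by apply: contraNneq zD => ->.
  have [c [Ez Ec]] := fr z zD.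
  have := freeze_row sE zi; rewrite Ez /=.
  have /negPf-> : s i != c.
    have := sEz z; rewrite Ez => /eqP <-.
    by rewrite (inj_eq perm_inj) eq_sym.
  by rewrite addn0 outfr // => ->; rewrite logfact1.
rewrite (eq_bigr _ Ei) exchange_big /= -big_split /=.
apply: ler_sum => z zD; rewrite big_split /= big_split /= sumr_const.
have -> : \sum_(i in D) - ((z == i)%:R * logfact (outdegree E z).-1) =
    - logfact (outdegree E z).-1 :> R.
  rewrite (bigD1 z) //= eqxx mul1r big1 ?addr0 // => i /andP[_ iz].
  by rewrite eq_sym (negPf iz) mul0r oppr0.
rewrite -mulr_suml -natr_sum.
(* A frozen row shares its target with no other row, so all targets of z are values s i with i in
   D. *)
have -> : (\sum_(i in D) E z (s i))%N = outdegree E z.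
  rewrite /outdegree -sum1_card big_mkcond /= [RHS]big_mkcond /=.
  rewrite [RHS](reindex_inj (@perm_inj _ s)); apply: eq_bigr => i _.
  rewrite inE; case: (boolP (i \in D)) => iD; first by case: (E z (s i)).
  have [c [Ei' Ec]] := fr i iD.
  have sic : s i = c by have := sEz i; rewrite Ei' => /eqP.
  by case: ifP => //; rewrite sic => /Ec zi; rewrite -zi zD in iD.
have : (0 < outdegree E z)%N.
  by rewrite /outdegree lt0n; apply/pred0Pn; exists (s z); rewrite inE.
case: (outdegree E z) => // r _; rewrite mulrBr logfact_mul factS natrM.
rewrite lnM ?posrE ?ltr0n ?fact_gt0 // -(logfact_mul r) [r.+1.-1]/= -natr1.
by rewrite -[_ *+ #|D|]mulr_natl; move: (logfact _) (#|D|%:R) => g d; lra.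
Qed.

(** Row v contributes ln 1 = 0, which leaves |V| - 1 rows in the exponent. *)
Theorem bregman_uniform E (v : V) (k : nat) : (0 < k)%N ->
  outdegree E v = 1%N -> (forall z, outdegree E z <= k)%N ->
  #|perms_in E|%:R <= (k`!%:R : R) `^ ((#|V|%:R - 1) / k%:R).
Proof.
move=> k0 Ev Ek; have k1 : k`!%:R != 0 :> R by rewrite pnatr_eq0 -lt0n fact_gt0.
rewrite /powR (negPf k1).
have [->|P0] := eqVneq #|perms_in E| 0%N; first exact: expR_ge0.
rewrite -ler_ln ?posrE ?expR_gt0 ?ltr0n ?lt0n // expRK.
apply: (le_trans (@bregman_frozen [set: V] E _)) => [i|]; first by rewrite inE.
have -> : (#|V|%:R - 1) / k%:R * ln (k`!%:R) =
    \sum_(z | z != v) logfact k :> R.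
  rewrite sumr_const (cardC1 v) -[RHS]mulr_natl /logfact.
  have V0 : (0 < #|V|)%N by apply/card_gt0P; exists v.
  by rewrite -subn1 natrB //; ring.
rewrite (bigD1 v) //= Ev logfact1 add0r.
by apply: ler_sum => z _; apply: logfact_le.
Qed.

End Bregman.

(** * Counting path-cycles *)

Section PathsToPermutations.
Variables (R : realType) (V : finType) (u v : V) (A : V -> V -> R) (P : rel V).
Hypothesis AP : forall z t, 0 <= A z t <= (P z t)%:R.

Definition path_rel : rel V :=
  fun z t => if z == v then t == u else (t == z) || P z t.

(* Here s is the path from u to w followed so far, closed up by w -> u. *)
Definition extensions (U : {set V}) w (s : {perm V}) : {set {perm V}} :=
  [set r : {perm V} | [forall z,
     if z \in w |: U then path_rel z (r z) else r z == s z]].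

(** Different next vertices x give disjoint sets of extensions r, told apart by r w = x. At w = v
    the permutation s itself is an extension. *)
Lemma pathsum_le_extensions (U : {set V}) w (s : {perm V}) : w \notin U ->
  (forall z, z \in U -> s z = z) -> s w = u ->
  pathsum v A U w <= #|extensions U w s|%:R.
Proof.
elim/walk_ind: U / w s => U w IH s wU sU sw; rewrite pathsumE.
case: (eqVneq w v) => [wv|wv].
  rewrite ler1n card_gt0; apply/finset.set0Pn; exists s; rewrite inE.
  apply/forallP => z; rewrite in_setU1 /path_rel.
  case: (eqVneq z w) => [->|zw] /=; first by rewrite wv eqxx -sw wv.
  case: ifP => // zU; have /negPf-> : z != v by rewrite -wv.
  by rewrite sU // eqxx.
(* It lengthens the closed path: w now goes to x, and x goes to u. *)
pose sx x := (tperm w x * s)%g.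
have le x : x \in U -> A w x * pathsum v A (U :\ x) x <=
    #|[set r in extensions U w s | r w == x]|%:R.
  move=> xU; have xw : x != w by apply: contraNneq wU => <-.
  have /andP[A0 A1] := AP w x.
  have N0 : 0 <= pathsum v A (U :\ x) x.
    by apply: pathsum_ge0 => z t; case/andP: (AP z t).
  move: A1; case: (boolP (P w x)) => Pwx A1; last first.
    have -> : A w x = 0 by apply/eqP; rewrite eq_le A0 A1.
    by rewrite mul0r.
  apply: (@le_trans _ _ (pathsum v A (U :\ x) x)); first by rewrite ler_piMl.
  apply: (@le_trans _ _ (#|extensions (U :\ x) x (sx x)|%:R)).
    apply: IH => //; first by rewrite !inE eqxx.
      move=> z; rewrite !inE => /andP[zx zU]; rewrite permM tpermD ?sU //.
        by apply: contraNneq wU => ->.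
      by rewrite eq_sym.
    by rewrite permM tpermR.
  rewrite ler_nat; apply/subset_leq_card/fintype.subsetP => r; rewrite !inE.
  move=> /forallP rE; have rw : r w == x.
    by have := rE w; rewrite finset.setD1K // (negPf wU) permM tpermL sU.
  rewrite rw andbT; apply/forallP => z; have := rE z.
  rewrite finset.setD1K // in_setU1; case: (eqVneq z w) => [->|zw] /=.
    by move=> _; rewrite /path_rel (negPf wv) (eqP rw) Pwx orbT.
  case: ifP => // zU; rewrite permM tpermD //; first by rewrite eq_sym.
  by apply/eqP => E; rewrite -E xU in zU.
apply: (le_trans (ler_sum _ le)); rewrite -natr_sum ler_nat.
rewrite -[leqRHS]sum1_card (partition_big (fun r : {perm V} => r w) predT) //=.
rewrite [leqRHS](bigID (mem U)) /= -[leqLHS]addn0 leq_add //.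
apply: leq_sum => x _; rewrite -sum1_card leq_eqVlt; apply/orP; left; apply/eqP.
by apply: eq_bigl => r; rewrite !inE.
Qed.

Lemma pathsum_le_perms :
  pathsum v A (~: [set u]) u <= #|perms_in path_rel|%:R.
Proof.
apply: (le_trans (pathsum_le_extensions (s := 1%g) _ _ _)).
- by rewrite !inE eqxx.
- by move=> z _; rewrite perm1.
- by rewrite perm1.
rewrite ler_nat; apply/subset_leq_card/fintype.subsetP => r; rewrite !inE.
move=> /forallP rE; apply/forallP => z; have := rE z.
by rewrite !inE orbN.
Qed.

(** The added loop raises the row sums to k + 1, while v keeps the single target u. *)
Lemma pathsum_le_fact k : (forall z, #|[pred t | P z t]| <= k)%N ->
  pathsum v A (~: [set u]) u <=
  (k.+1`!%:R : R) `^ ((#|V|%:R - 1) / k.+1%:R).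
Proof.
move=> Pk; apply: (le_trans pathsum_le_perms).
apply: (@bregman_uniform R V path_rel v) => // [|z].
  rewrite -(card1 u); apply: eq_card => t; rewrite !inE.
  by rewrite /path_rel eqxx.
rewrite /outdegree /path_rel; case: (eqVneq z v) => _.
  by rewrite (@leq_trans 1%N) // -(card1 u); apply/subset_leq_card/fintype.subsetP => t.
apply: (@leq_trans (#|pred1 z| + #|[pred t | P z t]|)); last first.
  by rewrite card1 add1n ltnS.
rewrite -cardUI; apply: (leq_trans _ (leq_addr _ _)).
by apply/subset_leq_card/fintype.subsetP => t; rewrite !inE.
Qed.

End PathsToPermutations.

(** * From path-cycles to path sums *)

Section CountPathCycles.
Variables (R : realType) (H : digraph).
Implicit Types (U : {set vert H}) (w u v : vert H) (e : edge H).

(** Edge sets of the paths counted by [pathsum_rec], with parallel edges kept apart. *)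
Fixpoint trails_rec v m U w : {set {set edge H}} :=
  if w == v then [set finset.set0] else
  if m is m'.+1 then
    \bigcup_(e | (src e == w) && (tgt e \in U))
      [set e |: D | D in trails_rec v m' (U :\ tgt e) (tgt e)]
  else finset.set0.

Definition trails v U w := trails_rec v #|U| U w.

Lemma trailsE v U w : trails v U w =
  if w == v then [set finset.set0] else
  \bigcup_(e | (src e == w) && (tgt e \in U))
    [set e |: D | D in trails v (U :\ tgt e) (tgt e)].
Proof.
rewrite /trails; case E : #|U| => [|m] /=.
  rewrite big_pred0 // => e; rewrite (cards0_eq E) inE andbF //.
case: ifP => // _; apply: eq_bigr => e /andP[_ eU].
by move: E; rewrite (cardsD1 (tgt e)) eU add1n => -[->].
Qed.

Lemma card_bigcup_le (I T : finType) (Q : pred I) (F : I -> {set T}) :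
  (#|\bigcup_(i | Q i) F i| <= \sum_(i | Q i) #|F i|)%N.
Proof.
elim/big_rec2: _ => [|i m A _ le]; first by rewrite cards0.
by rewrite (leq_trans (leq_card_setU _ _)) // leq_add2l.
Qed.

Definition adj u v : R := (mult u v)%:R.

(** Grouping the first edges by target produces the multiplicities as weights. *)
Lemma card_trails v U w : #|trails v U w|%:R <= pathsum v adj U w.
Proof.
elim/walk_ind: U / w => U w IH; rewrite trailsE pathsumE.
case: ifP => // _; first by rewrite cards1.
apply: (@le_trans _ _
  (\sum_(e | (src e == w) && (tgt e \in U)) pathsum v adj (U :\ tgt e) (tgt e))).
  apply: (@le_trans _ _ (\sum_(e | (src e == w) && (tgt e \in U))
      #|[set e |: D | D in trails v (U :\ tgt e) (tgt e)]|)%:R).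
    by rewrite ler_nat card_bigcup_le.
  rewrite natr_sum; apply: ler_sum => e /andP[_ eU]; apply: le_trans (IH _ eU).
  by rewrite ler_nat leq_imset_card.
rewrite (partition_big (fun e => tgt e) (mem U)) /=; last by move=> e /andP[].
rewrite le_eqVlt; apply/orP; left; apply/eqP; apply: eq_bigr => x xU.
rewrite (eq_bigr (fun=> pathsum v adj (U :\ x) x)); last first.
  by move=> e /andP[_ /eqP->].
rewrite sumr_const -mulr_natl; congr (_%:R * _); apply: eq_card => e.
rewrite !inE [LHS]unfold_in /=.
by case: (eqVneq (tgt e) x) => [->|]; rewrite ?andbF // xU !andbT.
Qed.

Definition closed_trails u v e : {set {set edge H}} :=
  [set e |: D | D in trails v (~: [set u]) u].

(** Every vertex of a path-cycle has an outgoing edge, so the edge set determines the subgraph;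
    removing the edge out of the last vertex leaves a path. *)
Lemma path_cycle_trail (X : subgraph H) : path_cycle (subgraph_digraph X) ->
  (val X).1 = [set src e | e in (val X).2] /\
  exists u v e, src e = v /\ (val X).2 \in closed_trails u v e.
Proof.
move=> [q [m [f [g [[f' fK f'K] [g' gK g'K] fg]]]]].
pose vs j : vert H := val (f' (inord j)).
pose es j : edge H := val (g' (inord j)).
have srcE i : src (g' i) = f' i.
  by have [] := fg (g' i); rewrite g'K /= => /(congr1 f'); rewrite fK => <-.
have tgtE (i : 'I_q.+1) : (i < q)%N -> tgt (g' i) = f' (inord i.+1).
  by move=> iq; have [_] := fg (g' i); rewrite g'K /= iq => /(congr1 f'); rewrite fK => <-.
have src_es j : src (es j) = vs j.
  by rewrite /es /vs -srcE.
have tgt_es j : (j < q)%N -> tgt (es j) = vs j.+1.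
  move=> jq; have jE : (inord j : 'I_q.+1) = j :> nat by rewrite inordK // ltnS ltnW.
  rewrite /es /vs; have := tgtE (inord j); rewrite jE => /(_ jq) <- //.
have vs_inj i j : (i <= q)%N -> (j <= q)%N -> vs i = vs j -> i = j.
  move=> iq jq /val_inj/(can_inj f'K)/(congr1 val).
  by rewrite /= !inordK.
have X2 e : (e \in (val X).2) = [exists i : 'I_q.+1, e == es i].
  apply/idP/existsP => [eX|[i /eqP->]]; last exact: valP.
  exists (g (exist _ e eX)); rewrite /es inord_val gK //.
split.
  apply/finset.setP => x; apply/idP/imsetP => [xX|[e eX ->]]; last first.
    by have /forall_inP/(_ e eX)/andP[] := valP X.
  exists (es (f (exist _ x xX))); first by rewrite X2; apply/existsP; eexists.
  by rewrite src_es /vs inord_val fK.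
(* The part of the path from [vs j] on, without the closing edge [es q]. *)
pose D j := [set e | [exists i : 'I_q.+1, [&& (j <= i)%N, (i < q)%N & e == es i]]].
have key d j U : (d + j = q)%N ->
    (forall i, (j < i <= q)%N -> vs i \in U) -> D j \in trails (vs q) U (vs j).
  elim: d j U => [|d IHd] j U dj HU; rewrite trailsE.
    rewrite -dj add0n eqxx inE; apply/eqP/setP => e; rewrite !inE.
    apply/negbTE/existsPn => i; apply/and3P => -[ji iq _].
    by move: (leq_ltn_trans ji iq); rewrite -dj add0n ltnn.
  have jq : (j < q)%N by rewrite -dj addSn ltnS leq_addl.
  have -> : (vs j == vs q) = false.
    apply/eqP => /(vs_inj _ _ (ltnW jq) (leqnn q)) jE; move: jq; by rewrite jE ltnn.
  apply/bigcupP; exists (es j).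
    by rewrite src_es eqxx tgt_es // HU // ltnSn.
  apply/imsetP; exists (D j.+1).
    rewrite tgt_es //; apply: IHd => [|i /andP[ji iq]].
      by rewrite addnS -addSn.
    rewrite !inE HU ?andbT; last by rewrite iq (ltn_trans _ ji).
    by apply/eqP => /(vs_inj _ _ iq jq) E; move: ji; rewrite E ltnn.
  apply/finset.setP => e; rewrite !inE; apply/existsP/orP => [[i /and3P[ji iq /eqP ->]]|].
    case: (eqVneq (i : nat) j) => [->|ij]; first by left.
    right; apply/existsP; exists i; rewrite iq eqxx !andbT.
    by rewrite ltn_neqAle eq_sym ij ji.
  case=> [/eqP->|/existsP[i /and3P[ji iq ei]]].
    have jE : (inord j : 'I_q.+1) = j :> nat by rewrite inordK // ltnS ltnW.
    by exists (inord j); rewrite jE leqnn jq eqxx.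
  by exists i; rewrite iq ei ltnW.
exists (vs 0%N), (vs q), (es q); split=> //; apply/imsetP; exists (D 0%N).
  apply: (key q); first by rewrite addn0.
  move=> i /andP[i0 iq]; rewrite !inE.
  by apply/eqP => /(vs_inj _ _ iq (leq0n q)) E; rewrite E in i0.
apply/finset.setP => e; rewrite X2 !inE; apply/existsP/orP => [[i /eqP ->]|].
  have := ltn_ord i; rewrite ltnS leq_eqVlt => /orP[/eqP->|iq]; first by left.
  by right; apply/existsP; exists i; rewrite iq eqxx.
case=> [/eqP->|/existsP[i /and3P[_ _ ei]]]; last by exists i.
by exists ord_max.
Qed.

Lemma num_path_cycles_le (k : nat) (B : R) : (forall v, outdeg v <= k)%N ->
  (forall u v, pathsum v adj (~: [set u]) u <= B) ->
  (num_path_cycles H)%:R <= #|vert H|%:R ^+ 2 * k%:R * B.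
Proof.
move=> Hk HB.
have le1 : (num_path_cycles H <=
    \sum_u \sum_v \sum_(e | src e == v) #|closed_trails u v e|)%N.
  rewrite /num_path_cycles; set S := [set X | _].
  have injS : {in S &, injective (fun X : subgraph H => (val X).2)}.
    move=> X Y; rewrite !inE => pX pY XY; apply: val_inj.
    have [X1 _] := path_cycle_trail pX; have [Y1 _] := path_cycle_trail pY.
    by move: X1 Y1 XY; case: (val X) (val Y) => [a b] [c d] /= -> -> ->.
  rewrite -(card_in_imset injS).
  apply: (@leq_trans #|\bigcup_u \bigcup_v \bigcup_(e | src e == v) closed_trails u v e|).
    apply/subset_leq_card/fintype.subsetP => _ /imsetP[X XS ->].
    move: XS; rewrite inE => pX.
    have [_ [u [v [e [ev Xe]]]]] := path_cycle_trail (asboolW pX).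
    apply/bigcupP; exists u => //; apply/bigcupP; exists v => //.
    by apply/bigcupP; exists e => //; apply/eqP.
  apply: leq_trans (card_bigcup_le _ _) _; apply: leq_sum => u _.
  apply: leq_trans (card_bigcup_le _ _) _; apply: leq_sum => v _.
  exact: card_bigcup_le.
(* With no vertices [HB] says nothing about the sign of B, but both sides are 0. *)
have [V0|V0] := posnP #|vert H|.
  move: le1; rewrite big_pred0 => [|u]; last by have := card0_eq V0 u; rewrite !inE.
  by rewrite leqn0 => /eqP->; rewrite V0 expr0n !mul0r.
have /card_gt0P[u0 _] := V0.
have B0 : 0 <= B.
  by apply: le_trans (HB u0 u0); apply: pathsum_ge0 => z t; apply: ler0n.
apply: (@le_trans _ _ (\sum_(u : vert H) \sum_(v : vert H) k%:R * B)); last first.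
  have C (x : R) : \sum_(i : vert H) x = #|vert H|%:R * x.
    by rewrite (eq_bigl (mem (vert H))) // sumr_const mulr_natl.
  by rewrite !C expr2 -!mulrA lexx.
apply: (@le_trans _ _ (\sum_u \sum_v \sum_(e | src e == v) B)).
  rewrite (le_trans (_ : _ <= (\sum_u \sum_v \sum_(e | src e == v) #|closed_trails u v e|)%:R)) //.
    by rewrite ler_nat.
  rewrite natr_sum; apply: ler_sum => u _; rewrite natr_sum; apply: ler_sum => v _.
  rewrite natr_sum; apply: ler_sum => e _; apply: le_trans (HB u v).
  by apply: le_trans (card_trails _ _ _); rewrite ler_nat leq_imset_card.
apply: ler_sum => u _; apply: ler_sum => v _.
rewrite (eq_bigl (mem [set e | src e == v])) => [|e]; last by rewrite /= inE.
by rewrite sumr_const -[leLHS]mulr_natl ler_wpM2r // ler_nat; apply: Hk.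
Qed.

End CountPathCycles.

(** * Multiplicities and the two bounds *)

Lemma outdeg_sum_mult (G : digraph) (u : vert G) :
  outdeg u = (\sum_v mult u v)%N.
Proof.
rewrite /outdeg -sum1_card (partition_big (fun e => tgt e) predT) //=.
apply: eq_bigr => v _; rewrite /mult -sum1_card.
by apply: eq_bigl => e; rewrite !inE.
Qed.

Lemma mult_of_mult (V : finType) (w : V -> V -> nat) (u v : V) :
  @mult (digraph_of_mult w) u v = w u v.
Proof.
pose F (p : V * V) := 'I_(w p.1 p.2).
have injF : injective (fun i : 'I_(w u v) => Tagged F (i : F (u, v))).
  by move=> i j /eqP; rewrite eq_Tagged /= => /eqP.
rewrite -[RHS]card_ord -cardsT -(card_imset _ injF); apply: eq_card => e.
rewrite inE; apply/andP/imsetP => [[] | [i _ ->]] //.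
case: e => -[u' v'] i /= /eqP uu /eqP vv.
by subst u' v'; exists i; rewrite ?inE.
Qed.

(** alpha(k) is the positive root of x^2 = (k - 1) x + 1. *)
Lemma alphaE (R : realType) (k : nat) :
  0 < alpha R k /\ alpha R k * alpha R k = (k%:R - 1) * alpha R k + 1.
Proof.
rewrite /alpha; set b := k%:R - 1; set s := Num.sqrt _.
have D0 : 0 <= b ^+ 2 + 4 by rewrite addr_ge0 ?sqr_ge0.
have s2 : s * s = b * b + 4 by rewrite -expr2 sqr_sqrtr // expr2.
have s0 : 0 <= s by apply: sqrtr_ge0.
split; last by move: s2; lra.
by rewrite divr_gt0 // ltNge; apply/negP => H; nra.
Qed.

Lemma nat_pred_cases (R : realType) (k : nat) : (2 <= k)%N ->
  let b : R := k%:R - 1 in b = 1 \/ b = 2 \/ 3 <= b.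
Proof.
case: k => [|[|[|[|k]]]] // _ /=; [left|right; left|right; right]; try lra.
by have := ler0n R k; rewrite -addn4 natrD; lra.
Qed.

Theorem proposition1 (R : realType) (n k : nat) (G : digraph)
    (hk : (2 <= k)%N) (hG : regular_digraph n k G) :
  (N1 k G)%:R <= 5 * n%:R ^+ 2 * k%:R * alpha R k ^ (n%:Z - 1)
  /\
  (N2 G)%:R <= n%:R ^+ 2 * k%:R
               * ((k.+1)`!%:R : R) `^ ((n%:R - 1) / k.+1%:R).
Proof.
have [nE kE] := hG.
have multk (u : vert G) : (\sum_v @mult G u v)%N = k by rewrite -outdeg_sum_mult kE.
have mult_le (u v : vert G) : (@mult G u v <= k)%N.
  by rewrite -(multk u) (bigD1 v) //= leq_addr.
have k1 : (0 < k)%N by apply: leq_trans hk.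
have [a0 aE] := @alphaE R k; set a := alpha R k in a0 aE *.
split.
  set w := fun u v : vert G => if pred1 k (mult u v) then 1%N else mult u v.
  have w_le u v : (w u v <= mult u v)%N by rewrite /w /=; case: eqP => // ->.
  (* Only the multiplicity k exceeds k - 1, and it is collapsed to 1; this gives the entry bound
     b. *)
  have w_lek u v : (w u v <= k.-1)%N.
    rewrite /w /=; case: eqP => [_|/eqP H]; first by rewrite -ltnS prednK.
    by rewrite -ltnS prednK // ltn_neqAle H mult_le.
  have bE : k%:R - 1 = k.-1%:R :> R by rewrite -subn1 natrB.
  have bH := nat_pred_cases R hk.
  have b0 : 0 <= k%:R - 1 :> R by rewrite bE.
  have le : (N1 k G)%:R <= #|vert G|%:R ^+ 2 * k%:R * a ^+ #|vert G|.-1.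
    apply: (@num_path_cycles_le R (digraph_of_mult w)) => [v|u v].
      rewrite outdeg_sum_mult -(multk v); apply: leq_sum => t _.
      by rewrite mult_of_mult.
    have le_pow := @pathsum_le_pow R (vert G) v (k%:R - 1) b0 a.
    apply: le_pow => // [|z t|z].
    - by rewrite !inE eqxx.
    - by rewrite /adj mult_of_mult ler0n bE ler_nat w_lek.
    rewrite subrK /adj -natr_sum ler_nat -[leqRHS](multk z); apply: leq_sum => t _.
    by rewrite mult_of_mult.
  apply: (le_trans le); rewrite nE.
  (* For n = 0 the integer exponent is -1, and the factor n^2 makes both sides 0. *)
  case: (n) => [|m]; first by rewrite expr0n /= !(mulr0, mul0r).
  have -> : m.+1%:Z - 1 = m by rewrite -addn1 PoszD addrK.
  rewrite -!mulrA ler_peMl // ?ler1n //.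
  by rewrite !mulr_ge0 ?ler0n ?exprn_ge0 // ltW.
set w := fun u v : vert G => if [pred d | (2 <= d)%N] (mult u v) then 1%N else mult u v.
have wE u v : w u v = (0 < mult u v)%N :> nat.
  by rewrite /w /=; case: (mult u v) => [|[|m]].
rewrite -nE; apply: (@num_path_cycles_le R (digraph_of_mult w)) => [v|u v].
  rewrite outdeg_sum_mult -(multk v); apply: leq_sum => t _.
  by rewrite mult_of_mult wE; move: (@mult G v t) => [].
apply: (@pathsum_le_fact R (vert G) u v _ (fun z t => (0 < @mult G z t)%N)) => [z t|z].
  by rewrite /adj mult_of_mult wE ler0n lexx.
rewrite -sum1_card -[leqRHS](multk z) big_mkcond; apply: leq_sum => t _.
by rewrite inE; case: (mult z t).
Qed.
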